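(* Let $p(\theta\mid x)$ and $q(\theta\mid x)$ be conditional probability densities on $\Theta$ (with respect to Lebesgue measure) for every $x\in\mathcal X$, and define the difference function $d_x(\theta)=p(\theta\mid x)-q(\theta\mid x)$. Let $\phi:\Theta\to\mathbb R^m$ be an embedding function such that $d_\phi(\theta_1,\theta_2)=\|\phi(\theta_1)-\phi(\theta_2)\|_2$ is a metric on $\Theta$, and suppose that $\phi$ satisfies the doubling condition with respect to Lebesgue measure. Assume that $p(x)$ is a probability density on $\mathcal X$ which is strictly positive almost everywhere. If, for every measurable function $\theta_l:\mathcal X\to\Theta$ and every $R>0$, $$\int_{\mathcal X}p(x)\left[\int_{B_\phi(\theta_l(x),R)}d_x(\theta)\,\mathrm d\theta\right]\mathrm dx=0,$$ then $d_x(\theta)=0$ for almost every $(x,\theta)\in\mathcal X\times\Theta$.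
   Context: $\Theta\subseteq\mathbb R^D$ is the (measurable) parameter space and $\mathcal X$ is the (measurable, Euclidean) space of conditioning inputs; $\mathrm d\theta$ and $\mathrm dx$ denote Lebesgue integration, and $(x,\theta)\mapsto p(\theta\mid x),\,q(\theta\mid x)$ are jointly measurable. $\phi$ is measurable. For $\theta\in\Theta$ and $R>0$, the $\phi$-ball is $B_\phi(\theta,R)=\{\theta'\in\Theta:\|\phi(\theta')-\phi(\theta)\|_2\le R\}$. The map $\phi$ satisfies the doubling condition with respect to a measure $\mu$ on $\Theta$ if there is a constant $C>0$ such that $\mu(B_\phi(\theta,2R))\le C\,\mu(B_\phi(\theta,R))$ for all $\theta\in\Theta$ and all $R>0$; here $\mu$ is Lebesgue measure on $\Theta$. *)

(* Defs.v *)
From HB Require Import structures.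
From mathcomp Require Import all_boot all_order all_algebra.
From mathcomp Require Import all_classical all_reals all_analysis.

Set Implicit Arguments.
Unset Strict Implicit.
Unset Printing Implicit Defensive.

Import Order.TTheory GRing.Theory Num.Theory.

Local Open Scope classical_set_scope.
Local Open Scope ring_scope.
Local Open Scope ereal_scope.

(* R^n is represented by n.-tuple R, whose canonical sigma-algebra is generated
   by the coordinate maps, i.e. it is the Borel sigma-algebra of R^n. *)

Section lebesgue_tuple.
Variable R : realType.

Definition tuple_cons n (z : R * n.-tuple R) : n.+1.-tuple R :=
  [the n.+1.-tuple R of z.1 :: z.2].

Definition tuple_uncons n (t : n.+1.-tuple R) : R * n.-tuple R :=
  (thead t, [tuple of behead t]).

Lemma tuple_consK n : cancel (@tuple_cons n) (@tuple_uncons n).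
Proof.
by move=> [x t]; rewrite /tuple_uncons theadE; congr pair; exact: val_inj.
Qed.

Lemma measurable_tuple_cons n : measurable_fun [set: _] (@tuple_cons n).
Proof. by apply: measurable_cons. Qed.

Lemma measurable_tuple_uncons n : measurable_fun [set: _] (@tuple_uncons n).
Proof.
apply/measurable_fun_pairP; split; first exact: (@measurable_tnth _ R _ ord0).
exact: measurable_behead.
Qed.

Section step.
Variables (n : nat) (mu : {sigma_finite_measure set (n.-tuple R) -> \bar R}).

Definition lebesgue_step : set (n.+1.-tuple R) -> \bar R :=
  pushforward (@lebesgue_measure R \x mu) (@tuple_cons n).

Let mcons := @measurable_tuple_cons n.
#[local] Hint Resolve mcons : core.

Let lebesgue_step0 : lebesgue_step set0 = 0.
Proof. exact: measure0. Qed.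

Let lebesgue_step_ge0 A : 0 <= lebesgue_step A.
Proof. exact: measure_ge0. Qed.

Let lebesgue_step_sigma_additive : semi_sigma_additive lebesgue_step.
Proof. exact: measure_semi_sigma_additive. Qed.

HB.instance Definition _ := isMeasure.Build _ _ _ lebesgue_step
  lebesgue_step0 lebesgue_step_ge0 lebesgue_step_sigma_additive.

Let lebesgue_step_sigma_finite : sigma_finite setT lebesgue_step.
Proof.
have /sigma_finiteP[F [TF ndF Foo]] := sigma_finiteT (@lebesgue_measure R).
have /sigma_finiteP[G [TG ndG Goo]] := sigma_finiteT mu.
exists (fun k => @tuple_uncons n @^-1` (F k `*` G k)).
  rewrite -preimage_bigcup; apply/esym/seteqP; split=> // t _.
  have [k _ Fk] : (\bigcup_k F k) (thead t) by rewrite -TF.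
  have [l _ Gl] : (\bigcup_l G l) [tuple of behead t] by rewrite -TG.
  exists (maxn k l) => //; split=> /=.
    by move: Fk; exact/subsetPset/ndF/leq_maxl.
  by move: Gl; exact/subsetPset/ndG/leq_maxr.
move=> k; have [mF Fk] := Foo k; have [mG Gk] := Goo k; split.
  rewrite -[X in measurable X]setTI; apply: measurable_tuple_uncons => //.
  exact: measurableX.
rewrite /lebesgue_step /pushforward -comp_preimage.
rewrite (_ : _ \o _ = id); last by apply/funext => z; exact: tuple_consK.
by rewrite preimage_id product_measure1E// lte_mul_pinfty// ge0_fin_numE.
Qed.

HB.instance Definition _ := Measure_isSigmaFinite.Build _ _ _ lebesgue_step
  lebesgue_step_sigma_finite.

End step.

(* Lebesgue measure on R^n: the point mass on R^0 and, under the identification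
   R^(n+1) = R x R^n, the product of Lebesgue measures. *)
Fixpoint lebesgue_tuple n : {sigma_finite_measure set (n.-tuple R) -> \bar R} :=
  match n return {sigma_finite_measure set (n.-tuple R) -> \bar R} with
  | 0 => \d_ [tuple]
  | n'.+1 => lebesgue_step (lebesgue_tuple n')
  end.

Lemma lebesgue_tuple_box n (A : 'I_n -> set R) :
  (forall i, measurable (A i)) ->
  lebesgue_tuple n [set t | forall i, A i (tnth t i)] =
  \prod_(i < n) lebesgue_measure (A i).
Proof.
elim: n A => [|n IH] A mA.
  rewrite big_ord0 /= diracE.
  by rewrite (_ : _ \in _) // inE => -[].
have mB : measurable [set t : n.-tuple R | forall i, A (lift ord0 i) (tnth t i)].
  rewrite (_ : mkset _ = \bigcap_(i in [set: 'I_n])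
      ((fun t : n.-tuple R => tnth t i) @^-1` A (lift ord0 i))); last first.
    by apply/seteqP; split=> t /= At i; [move=> _; exact: At | exact: At].
  apply: fin_bigcap_measurable => // i _.
  by rewrite -[X in measurable X]setTI; exact: measurable_tnth.
rewrite big_ord_recl -IH // -product_measure1E//=; last exact: (mA ord0).
rewrite /lebesgue_step /pushforward; congr ((_ \x _) _).
apply/seteqP; split=> -[x t] /= => [At|[Ax At] i].
  split; first exact: (At ord0).
  by move=> i; have := At (lift ord0 i); rewrite tnthS.
by case: (unliftP ord0 i) => [j ->|->//]; rewrite tnthS.
Qed.

End lebesgue_tuple.

Definition is_density d (T : measurableType d) (R : realType)
    (mu : set T -> \bar R) (A : set T) (f : T -> R) : Prop :=
  [/\ measurable_fun A f,
      forall x, A x -> (0 <= f x)%R &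
      \int[mu]_(x in A) (f x)%:E = 1].

Definition is_metric_on (T : Type) (R : realType) (A : set T)
    (dist : T -> T -> R) : Prop :=
  [/\ forall x y, A x -> A y -> (0 <= dist x y)%R,
      forall x y, A x -> A y -> (dist x y = 0%R <-> x = y),
      forall x y, A x -> A y -> dist x y = dist y x &
      forall x y z, A x -> A y -> A z ->
        (dist x z <= dist x y + dist y z)%R].

Section embedding.
Variable R : realType.

Definition euclidean_dist m (u v : m.-tuple R) : R :=
  Num.sqrt (\sum_(i < m) (tnth u i - tnth v i) ^+ 2).

Variables (T : Type) (m : nat) (Theta : set T) (phi : T -> m.-tuple R).

Definition embedding_dist (t1 t2 : T) : R := euclidean_dist (phi t1) (phi t2).

Definition embedding_ball (t : T) (r : R) : set T :=
  [set t' | Theta t' /\ (embedding_dist t' t <= r)%R].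

(* The measure mu takes values in [0, +oo]; balls are not assumed to have
   finite or nonzero measure. *)
Definition doubling (mu : set T -> \bar R) : Prop :=
  exists2 C : R, (0 < C)%R &
    forall t, Theta t -> forall r : R, (0 < r)%R ->
      mu (embedding_ball t (2 * r)) <= C%:E * mu (embedding_ball t r).

End embedding.

(* Main.v *)
(* Write f_x = p(.|x) - q(.|x). Taking theta_l equal to t on a set E and to t0
   off E, and letting E vary, shows that for almost every x the integral of f_x
   over a phi-ball does not depend on the centre of the ball. A Gaussian
   K(s, t) = exp (- a |phi s - phi t|^2) is a limit of combinations of
   indicators of balls around t, so its integral against f_x is a constant
   function of t; as f_x has integral 0, the double integral of K against f_x
   vanishes. Expanding exp (2 a <phi s, phi t>) in power series turns it into a
   series of squares, hence all moments of exp (- a |phi|^2) against f_x vanish,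
   and f_x integrates to 0 over every preimage phi^-1 Q. As phi is injective,
   such preimages exhaust all measurable sets up to small sets: a compact subset
   of the graph of phi over A has a compact projection. The doubling condition
   is replaced by the Euclidean structure of the target of phi. *)

Require Import Defs.
From HB Require Import structures.
From mathcomp Require Import all_boot all_order all_algebra.
From mathcomp Require Import all_classical all_reals all_analysis.
From mathcomp Require Import measurable_realfun.
From mathcomp Require Import ring lra.

Set Implicit Arguments.
Unset Strict Implicit.
Unset Printing Implicit Defensive.

Import Order.TTheory GRing.Theory Num.Theory.
Import numFieldNormedType.Exports.

Local Open Scope classical_set_scope.
Local Open Scope ring_scope.

(** * Algebras of bounded functions *)

(** Two obstacles shape the argument. The null set of x discarded when two centres are compared
    depends on the centres, which are uncountably many. Using natural a and countably many radii,
    Fubini trades every t and almost every x for almost every x and almost every t; this suffices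
    because the potential is then only integrated against f_x. Moreover phi is merely measurable, so
    images of measurable sets under it have no evident measurability; the graph, cut out by
    equations, and its compact subsets avoid such images. From moments to preimages the argument is
    of monotone class type: products of the bounded functions exp(-|phi|^2) and exp(-|phi|^2) phi_i
    are monomials weighted by exp(-a |phi|^2), where a is the number of factors, so every integer a
    >= 1 occurs. *)

Lemma bernoulli_le (R : realFieldType) (a : R) n :
  0 <= a <= 1 -> 1 - n%:R * a <= (1 - a) ^+ n.
Proof.
move=> /andP[a0 a1]; elim: n => [|n IH]; first by rewrite mul0r subr0 expr0.
rewrite exprS -natr1.
have IHa : (1 - a) * (1 - n%:R * a) <= (1 - a) * (1 - a) ^+ n.
  by rewrite ler_wpM2l// subr_ge0.
apply: le_trans IHa.
have : 0 <= n%:R * a * a by rewrite !mulr_ge0.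
nra.
Qed.

Lemma bernoulli_ge (R : realFieldType) (a : R) n :
  0 <= a <= 1 -> (1 + n%:R * a) * (1 - a) ^+ n <= 1.
Proof.
move=> /andP[a0 a1].
elim: n => [|n IH]; first by rewrite mul0r addr0 expr0 mulr1.
apply: le_trans IH; rewrite exprS mulrA ler_wpM2r ?exprn_ge0 ?subr_ge0//.
rewrite -natr1.
have : 0 <= n%:R * a * a by rewrite !mulr_ge0.
nra.
Qed.

(** With y the square root of x, Bernoulli gives n y^n <= 1 / (1 - y), so n x^n = (n y^n) y^n is
    dominated by a geometric sequence. *)
Lemma cvg_natr_mul_expr (R : realType) (x : R) :
  0 <= x < 1 -> (n%:R * x ^+ n) @[n --> \oo] --> (0 : R).
Proof.
move=> /andP[x0 x1]; pose y := Num.sqrt x.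
have y0 : 0 <= y by exact: sqrtr_ge0.
have yy : y ^+ 2 = x by rewrite sqr_sqrtr.
have y1 : y < 1 by rewrite -sqrtr1 ltr_sqrt.
have cy : (((1 - y)^-1 * y ^+ n) : R) @[n --> \oo] --> (0 : R).
  by apply: cvg_geometric; rewrite ger0_norm.
apply: (squeeze_cvgr _ (@cvg_cst _ (0 : R) _ \oo _) cy).
apply: nearW => n; rewrite mulr_ge0 ?exprn_ge0//=.
rewrite -yy -exprM mulnC exprM expr2 mulrA ler_wpM2r ?exprn_ge0//.
rewrite -[X in _ <= X]mul1r ler_pdivlMr ?subr_gt0//.
have := @bernoulli_ge R (1 - y) n.
rewrite subr_ge0 subKr (ltW y1) lerBlDl lerDr y0 => /(_ isT).
have : 0 <= y ^+ n by rewrite exprn_ge0.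
nra.
Qed.

(** Bernoulli controls the power through exponent times u^n, that is n (2u)^n, which tends to 0
    below 1/2 and is at least n from 1/2 on. The factor n in the exponent settles the boundary case
    u = 1/2. Such polynomials in u appear in elementary proofs of Stone-Weierstrass. *)
Lemma cvg_half_threshold (R : realType) (u : R) : 0 <= u <= 1 ->
  (1 - u ^+ n) ^+ (n * 2 ^ n) @[n --> \oo] --> ((u < 2^-1)%R%:R : R).
Proof.
move=> /andP[u0 u1].
have un n : 0 <= u ^+ n <= 1 by rewrite exprn_ge0//= exprn_ile1.
have un' n : 0 <= 1 - u ^+ n by rewrite subr_ge0; case/andP: (un n).
have N n : (n * 2 ^ n)%:R * u ^+ n = n%:R * (2 * u) ^+ n.
  by rewrite natrM natrX exprMn mulrA.
case: ltP => u2 /=.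
  have c : (1 - n%:R * (2 * u) ^+ n) @[n --> \oo] --> (1 - 0 : R).
    apply: cvgB; first exact: cvg_cst.
    by apply: cvg_natr_mul_expr; rewrite mulr_ge0//= -ltr_pdivlMl// mulr1.
  rewrite subr0 in c.
  apply: (squeeze_cvgr _ c (@cvg_cst _ (1 : R) _ \oo _)).
  apply: nearW => n; rewrite -N bernoulli_le//= exprn_ile1//.
  by rewrite lerBlDl lerDr; case/andP: (un n).
apply: (squeeze_cvgr _ (@cvg_cst _ (0 : R) _ \oo _) (@cvg_harmonic R)).
apply: nearW => n; rewrite exprn_ge0//=.
rewrite -[leRHS]mul1r ler_pdivlMr ?ltr0n// mulrC.
apply: le_trans (bernoulli_ge (n * 2 ^ n) (un n)).
rewrite ler_wpM2r ?exprn_ge0// N -natr1 addrC lerD2l ler_peMr// exprn_ege1//.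
by rewrite mulrC -ler_pdivrMr// mul1r.
Qed.

(* Modelled on the bounded functions measurable for a sub-sigma-algebra; the
   boundedness of the members is only required along limits. *)
Record bounded_algebra (T : Type) (R : realType) (M : set (T -> R)) : Prop := {
  bounded_algebra_cst : forall c, M (cst c) ;
  bounded_algebraD : forall g h, M g -> M h -> M (g \+ h) ;
  bounded_algebraM : forall g h, M g -> M h -> M (g \* h) ;
  bounded_algebra_lim : forall (g : nat -> T -> R) h (K : R),
    (forall n, M (g n)) -> (forall n t, `|g n t| <= K) ->
    (forall t, g ^~ t @ \oo --> h t) -> M h }.

Section bounded_algebra_theory.
Variables (T : pointedType) (R : realType) (M : set (T -> R)).
Hypothesis MA : bounded_algebra M.

Lemma bounded_algebraX u n : M u -> M (fun t => u t ^+ n).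
Proof.
move=> Mu; elim: n => [|n IH]; first exact: (bounded_algebra_cst MA 1).
rewrite (_ : (fun _ => _) = u \* (fun t => u t ^+ n)).
  exact: bounded_algebraM.
by apply/funext => t; rewrite exprS.
Qed.

Lemma bounded_algebra_onem u : M u -> M (fun t => 1 - u t).
Proof.
move=> Mu; rewrite (_ : (fun _ => _) = cst 1 \+ (cst (-1) \* u)).
  by apply: (bounded_algebraD MA); [exact: bounded_algebra_cst|
     apply: (bounded_algebraM MA) => //; exact: bounded_algebra_cst].
by apply/funext => t /=; rewrite mulN1r.
Qed.

Lemma bounded_algebra_lt_half u : M u -> (forall t, 0 <= u t <= 1) ->
  M \1_[set t | u t < 2^-1].
Proof.
move=> Mu u01.
apply: (bounded_algebra_lim MA (K := 1)
    (g := fun n t => (1 - u t ^+ n) ^+ (n * 2 ^ n))).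
- by move=> n; apply/bounded_algebraX/bounded_algebra_onem/bounded_algebraX.
- move=> n t; have /andP[u0 u1] := u01 t.
  have un : u t ^+ n <= 1 by rewrite exprn_ile1.
  rewrite ger0_norm ?exprn_ge0 ?subr_ge0// exprn_ile1 ?subr_ge0//.
  by rewrite lerBlDl lerDr exprn_ge0.
- move=> t; rewrite indicE.
  rewrite (_ : (t \in _) = (u t < 2^-1)); first exact: cvg_half_threshold.
  by apply/idP/idP; rewrite inE.
Qed.

(** An affine change of variable brings the level c to 1/2 and the range of u into [0, 1]; the
    summand 1 in [s] keeps the denominator positive. *)
Lemma bounded_algebra_lt u (K c : R) : M u -> (forall t, `|u t| <= K) ->
  M \1_[set t | u t < c].
Proof.
move=> Mu uK; pose s := (2 * (`|K| + `|c| + 1))^-1.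
have k0 : 0 <= `|K| by []. have c0 : 0 <= `|c| by [].
have s0 : 0 < s by rewrite invr_gt0; lra.
have sE : s * (`|K| + `|c| + 1) = 2^-1.
  rewrite /s invfM -mulrA mulVf ?mulr1//; lra.
rewrite (_ : [set t | u t < c] = [set t | 2^-1 + (u t - c) * s < 2^-1]).
  apply: bounded_algebra_lt_half.
    rewrite (_ : (fun _ => _) = cst (2^-1 - c * s) \+ (cst s \* u)).
      by apply: (bounded_algebraD MA); [exact: bounded_algebra_cst|
        apply: (bounded_algebraM MA) => //; exact: bounded_algebra_cst].
    by apply/funext => t /=; rewrite mulrBl mulrC; ring.
  move=> t; have Kt := uK t.
  have : `|u t - c| <= `|K| + `|c| + 1.
    rewrite (le_trans (ler_normB _ _))// -addrA lerD//.
      exact: le_trans (ler_norm _).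
    by rewrite lerDl.
  move=> /(ler_wpM2r (ltW s0)); rewrite [X in _ <= X]mulrC sE.
  rewrite -{1}(gtr0_norm s0) -normrM ler_norml => /andP[? ?].
  by apply/andP; split; lra.
apply/seteqP; split => t /=.
  by move=> uc; rewrite -ltrBrDl subrr pmulr_llt0// subr_lt0.
by rewrite -ltrBrDl subrr pmulr_llt0// subr_lt0.
Qed.

Definition algebra_sets : set (set T) := [set A | M \1_A].

Lemma sigma_algebra_algebra_sets : sigma_algebra setT algebra_sets.
Proof.
have AC A : algebra_sets A -> algebra_sets (~` A).
  move=> MA_; rewrite /algebra_sets /=.
  rewrite (_ : \1_(~` A) = (fun t => 1 - \1_A t)).
    exact: bounded_algebra_onem.
  apply/funext => t; rewrite indicC indicE.
  by case: (t \in A); rewrite /= ?subrr ?subr0.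
have A0 : algebra_sets set0.
  by rewrite /algebra_sets /= indic0; exact: bounded_algebra_cst.
have AI A B : algebra_sets A -> algebra_sets B -> algebra_sets (A `&` B).
  by move=> ? ?; rewrite /algebra_sets /= indicI; exact: bounded_algebraM.
have AU A B : algebra_sets A -> algebra_sets B -> algebra_sets (A `|` B).
  by move=> ? ?; rewrite -[_ `|` _]setCK setCU; apply/AC/AI; exact: AC.
split => // [A MA_|F MF]; first by rewrite setTD; exact: AC.
(* Indicators of finite unions are bounded by 1 and converge pointwise, so closure under bounded
   limits gives the countable union. *)
pose G n := \bigcup_(i in `I_n) F i.
have MG n : M \1_(G n).
  rewrite -[M _]/(algebra_sets (G n)) /G bigcup_mkord.
  by elim/big_ind : _ => //.
apply: (bounded_algebra_lim MA (K := 1) MG).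
  by move=> n t; rewrite indicE; case: (_ \in _); rewrite ?normr1 ?normr0.
move=> t; have [Ft|Ft] := pselect ((\bigcup_n F n) t).
  have [n _ Fnt] := Ft; rewrite indicE mem_set//.
  apply: cvg_near_cst; exists n.+1 => // k /= nk.
  by rewrite indicE mem_set//; exists n.
rewrite indicE memNset//; apply: cvg_near_cst; apply: nearW => k.
by rewrite indicE memNset// => -[i _ Fit]; apply: Ft; exists i.
Qed.

Lemma measurable_algebra_setsE (A : set (g_sigma_algebraType algebra_sets)) :
  measurable A -> M \1_A.
Proof.
by move=> mA; apply: (mA algebra_sets); split => //;
  exact: sigma_algebra_algebra_sets.
Qed.

Lemma measurable_fun_algebra_sets (u : T -> R) (K : R) :
  M u -> (forall t, `|u t| <= K) ->
  measurable_fun setT (u : g_sigma_algebraType algebra_sets -> R).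
Proof.
move=> Mu uK; apply: (measurability (@RGenCInfty.G R)).
  exact: RGenCInfty.measurableE.
move=> _ [_ [c ->] <-]; rewrite setTI.
rewrite -[X in measurable X]setCK; apply: measurableC.
apply: sub_sigma_algebra; rewrite /algebra_sets /=.
rewrite (_ : ~` _ = [set t | u t < c]); first exact: bounded_algebra_lt uK.
apply/seteqP; split => t /=; rewrite in_itv/= andbT.
  by move=> /negP; rewrite -ltNge.
by move=> utc; apply/negP; rewrite -ltNge.
Qed.

End bounded_algebra_theory.

(** * Integration of bounded functions against a fixed integrable f *)

Section bounded_measurable.
Context d (T : measurableType d) (R : realType).
Implicit Types F G : T -> R.

Definition bounded_measurable : set (T -> R) :=
  [set F : T -> R | measurable_fun setT F /\ exists K, forall t, `|F t| <= K].

Lemma bounded_measurable_algebra : bounded_algebra bounded_measurable.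
Proof.
split.
- by move=> c; split => //; exists `|c|.
- move=> F G [mF [K FK]] [mG [K' GK]]; split; first exact: measurable_funD.
  by exists (K + K') => t; rewrite (le_trans (ler_normD _ _))// lerD.
- move=> F G [mF [K FK]] [mG [K' GK]]; split; first exact: measurable_funM.
  by exists (K * K') => t; rewrite normrM ler_pM.
- move=> F G K bF FK FG; split.
    by apply: (measurable_fun_cvg (h := F)) => [n|t _]; [case: (bF n)|exact: FG].
  exists K => t; apply: (cvgr_to_le (cvg_norm (FG t))).
  exact: nearW.
Qed.

Lemma bounded_measurableZ c F :
  bounded_measurable F -> bounded_measurable (fun t => c * F t).
Proof.
have [cst_ _ mul _] := bounded_measurable_algebra.
by move=> bF; apply: (mul (cst c)).
Qed.

Lemma bounded_measurable_sum (I : Type) (s : seq I) (F : I -> T -> R) :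
  (forall i, bounded_measurable (F i)) ->
  bounded_measurable (fun t => \sum_(i <- s) F i t).
Proof.
move=> bF; elim: s => [|i s IH].
  rewrite (_ : (fun _ => _) = cst 0).
    exact: (bounded_algebra_cst bounded_measurable_algebra).
  by apply/funext => t; rewrite big_nil.
rewrite (_ : (fun _ => _) = F i \+ (fun t => \sum_(i <- s) F i t)).
  exact: (bounded_algebraD bounded_measurable_algebra).
by apply/funext => t; rewrite big_cons.
Qed.

Variables (mu : {measure set T -> \bar R}) (f : T -> R).
Hypothesis intf : mu.-integrable setT (EFin \o f).

Definition integral_against F : R := \int[mu]_t (F t * f t).

Local Notation L := integral_against.

Lemma bounded_measurable_integrable F : bounded_measurable F ->
  mu.-integrable setT (EFin \o (F \* f)).
Proof.
move=> [mF [K FK]].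
rewrite (_ : EFin \o _ = (EFin \o F) \* (EFin \o f))%E; last exact/funext.
apply: integrableMr => //.
by exists K; split; [exact: num_real|move=> x Kx t _; exact: le_trans (FK t) (ltW Kx)].
Qed.

Lemma integral_againstD F G : bounded_measurable F -> bounded_measurable G ->
  L (fun t => F t + G t) = L F + L G.
Proof.
move=> bF bG; rewrite /L -RintegralD//; [|exact: bounded_measurable_integrable..].
by apply: eq_Rintegral => t _; rewrite mulrDl.
Qed.

Lemma integral_againstZ c F : bounded_measurable F ->
  L (fun t => c * F t) = c * L F.
Proof.
move=> bF; rewrite /L -RintegralZl//; last exact: bounded_measurable_integrable.
by apply: eq_Rintegral => t _; rewrite mulrA.
Qed.

Lemma integral_against_sum (I : Type) (s : seq I) (F : I -> T -> R) :
  (forall i, bounded_measurable (F i)) ->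
  L (fun t => \sum_(i <- s) F i t) = \sum_(i <- s) L (F i).
Proof.
move=> bF; elim: s => [|i s IH].
  rewrite big_nil /L; under eq_Rintegral do rewrite big_nil mul0r.
  by rewrite Rintegral_cst// mul0r.
rewrite big_cons -IH -integral_againstD//; last exact: bounded_measurable_sum.
by congr L; apply/funext => t; rewrite big_cons.
Qed.

Lemma integral_against_lim (F : nat -> T -> R) G (K : R) :
  (forall n, bounded_measurable (F n)) -> (forall n t, `|F n t| <= K) ->
  (forall t, F ^~ t @ \oo --> G t) -> L (F n) @[n --> \oo] --> L G.
Proof.
move=> bF FK FG.
have bG := bounded_algebra_lim bounded_measurable_algebra bF FK FG.
have iF n := bounded_measurable_integrable (bF n).
have iG := bounded_measurable_integrable bG.
have iK : mu.-integrable setT (fun t => K%:E * (abse \o (EFin \o f)) t)%E.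
  by apply: integrableZl => //; exact: integrable_abse.
have [] := @dominated_convergence _ _ _ mu setT measurableT
  (fun n => EFin \o (F n \* f)) (EFin \o (G \* f)) _ _ _ _ iK _.
- by move=> n; exact: (measurable_int mu).
- exact: (measurable_int mu).
- apply: aeW => t _; apply/fine_cvgP; split; first exact: nearW.
  by apply: cvgM; [exact: FG|exact: cvg_cst].
- apply: aeW => t n _ /=; rewrite -EFinM lee_fin normrM.
  by rewrite ler_wpM2r//.
- move=> _ _ h; rewrite /L /Rintegral.
  apply: fine_cvg; rewrite fineK//.
  exact: integrable_fin_num.
Qed.

End bounded_measurable.

Section gaussian_moments.
Context d (T : measurableType d) (R : realType).
Variables (mu : {measure set T -> \bar R}) (f : T -> R).
Hypothesis intf : mu.-integrable setT (EFin \o f).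

Local Notation L := (integral_against mu f).

(* Multiplying by the generators preserves the functions all of whose moments
   vanish, so the multipliers of that space form an algebra annihilated by L. *)
Lemma moments0_algebra (I : Type) (y : I -> T -> R) :
  (forall i, bounded_measurable (y i)) ->
  (forall s, L (fun t => \prod_(i <- s) y i t) = 0) ->
  exists M, [/\ bounded_algebra M, forall i, M (y i) &
    forall F, M F -> L F = 0].
Proof.
move=> by_ L0; pose b s t := \prod_(i <- s) y i t.
have [bcst bD bM blim] := @bounded_measurable_algebra _ T R.
have bb s : bounded_measurable (b s).
  elim: s => [|i s IH].
    rewrite (_ : b _ = cst 1); first exact: bcst.
    by apply/funext => t; rewrite /b big_nil.
  rewrite (_ : b _ = y i \* b s); first exact: bM.
  by apply/funext => t; rewrite /b big_cons.
pose Z := [set F : T -> R | bounded_measurable F /\ forall s, L (F \* b s) = 0].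
pose M := [set g : T -> R | bounded_measurable g /\ forall F, Z F -> Z (F \* g)].
have Z1 : Z (cst 1).
  split => [|s]; first exact: bcst.
  by rewrite -[RHS](L0 s); congr L; apply/funext => t /=; rewrite mul1r.
exists M; split.
- split.
  + move=> c; split => [|F [bF F0]]; first exact: bcst.
    split=> [|s]; first by apply: bM => //; exact: bcst.
    transitivity (c * L (F \* b s)); last by rewrite F0 mulr0.
    rewrite -integral_againstZ//; last exact: bM.
    by congr L; apply/funext => t /=; ring.
  + move=> g h [bg Zg] [bh Zh]; split => [|F ZF]; first exact: bD.
    have [bFg Fg] := Zg _ ZF; have [bFh Fh] := Zh _ ZF.
    split=> [|s]; first by apply: bM; [case: ZF|exact: bD].
    transitivity (L (F \* g \* b s) + L (F \* h \* b s)).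
      rewrite -integral_againstD//; [|exact: bM..].
      by congr L; apply/funext => t /=; ring.
    by rewrite Fg Fh addr0.
  + move=> g h [bg Zg] [bh Zh]; split => [|F ZF]; first exact: bM.
    have := Zh _ (Zg _ ZF); congr Z; apply/funext => t /=; ring.
  + move=> g h K Mg gK gh.
    have bh : bounded_measurable h by apply: (blim g _ K) => // n; case: (Mg n).
    split => // F ZF; split=> [|s]; first by apply: bM => //; case: ZF.
    have [[_ [K1 FK1]] [_ [K2 bK2]]] := (ZF.1, bb s).
    have := @integral_against_lim _ _ _ _ _ intf
      (fun n => F \* g n \* b s) (F \* h \* b s) (K1 * K * K2).
    have -> : (fun n => L (F \* g n \* b s)) = (fun=> 0).
      by apply/funext => n; have [_ Zg] := Mg n; have [_ ->] := Zg _ ZF.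
    move=> hlim; apply/esym.
    apply: (@cvg_unique _ (@Rhausdorff R) _ _ _ _ (@cvg_cst _ (0 : R) _ \oo _)).
    apply: hlim => [n|n t|t].
    * by apply: (bM _ _) => //; apply: (bM _ _); [case: ZF|case: (Mg n)].
    * by rewrite !normrM !ler_pM// mulr_ge0.
    * by apply: cvgM; [apply: cvgM => //; exact: cvg_cst|exact: cvg_cst].
- move=> i; split => // F [bF F0]; split => [|s]; first exact: bM.
  rewrite -[RHS](F0 (i :: s)); congr L; apply/funext => t /=.
  by rewrite /b big_cons mulrA.
(* Let the multiplier [F] act on the constant 1, which lies in [Z] because the moments vanish, and
   test with the empty product. *)
- move=> F [_ MF]; have [_ /(_ [::])] := MF _ Z1.
  move=> LF; rewrite -[RHS]LF; congr L; apply/funext => t /=.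
  by rewrite /b big_nil mul1r mulr1.
Qed.

End gaussian_moments.

(** * Gaussian kernels *)

Lemma series_exp_coeff_le (R : realType) (x : R) n :
  `|series (exp_coeff x) n| <= expR `|x|.
Proof.
apply: (le_trans (ler_norm_sum _ _ _)).
rewrite (eq_bigr (exp_coeff `|x|)); last first.
  by move=> i _; rewrite /exp_coeff /= normrM normrX normfV normr_nat.
apply: (nondecreasing_cvgn_le (u_ := series (exp_coeff `|x|))).
  by apply: nondecreasing_series => i _; rewrite /exp_coeff /= divr_ge0 ?exprn_ge0.
exact: is_cvg_series_exp_coeff.
Qed.

Section gaussian_kernel.
Context d (T : measurableType d) (R : realType).
Variables (m : nat) (phi : T -> m.-tuple R).
Hypothesis mphi : measurable_fun setT phi.

Definition sqr_norm (u : m.-tuple R) : R := \sum_(i < m) tnth u i ^+ 2.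

Definition dot (u v : m.-tuple R) : R := \sum_(i < m) tnth u i * tnth v i.

Definition gauss_monomial (a : nat) (s : seq 'I_m) (t : T) : R :=
  expR (- (a%:R * sqr_norm (phi t))) * \prod_(i <- s) tnth (phi t) i.

Definition gauss_kernel (a : nat) (s t : T) : R :=
  expR (- (a%:R * \sum_(i < m) (tnth (phi s) i - tnth (phi t) i) ^+ 2)).

Lemma sqr_norm_ge0 u : 0 <= sqr_norm u.
Proof. by apply: sumr_ge0 => i _; exact: sqr_ge0. Qed.

Lemma sqr_tnth_le u i : tnth u i ^+ 2 <= sqr_norm u.
Proof.
rewrite /sqr_norm (bigD1 i)//= lerDl; apply: sumr_ge0 => j _; exact: sqr_ge0.
Qed.

Lemma normr_tnth_le u i : `|tnth u i| <= 1 + sqr_norm u.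
Proof.
apply: (le_trans _ (lerD (lexx 1) (sqr_tnth_le u i))).
by rewrite -real_normK ?num_real//; move: `|_| => y; nra.
Qed.

Lemma measurable_tnth_phi i : measurable_fun setT (fun t => tnth (phi t) i).
Proof. exact: measurableT_comp (measurable_tnth i) mphi. Qed.

Lemma measurable_gauss_monomial a s : measurable_fun setT (gauss_monomial a s).
Proof.
apply: measurable_funM; last first.
  by apply: measurable_prod => i _; exact: measurable_tnth_phi.
apply: measurableT_comp => //; apply: measurableT_comp => //.
apply: measurable_funM => //; apply: measurable_sum => i.
by apply: measurable_funX; exact: measurable_tnth_phi.
Qed.

(** With q = |phi t|^2 and l the length of [s], the monomial is at most (1 + q)^(l+1) <= (l+1)!
    exp(1 + q), and a >= 1 bounds the Gaussian factor by exp(-q). *)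
Lemma normr_gauss_monomial_le a s t : (0 < a)%N ->
  `|gauss_monomial a s t| <= (size s).+1`!%:R * expR 1.
Proof.
move=> a0; have q0 := sqr_norm_ge0 (phi t); set q := sqr_norm _ in q0 *.
rewrite normrM ger0_norm ?expR_ge0// normr_prod.
(* The exponent is raised by one because [expR_ge1Dxn] bounds positive powers. *)
have monle : \prod_(i <- s) `|tnth (phi t) i| <= (1 + q) ^+ (size s).+1.
  have q1 : 1 <= 1 + q by rewrite lerDl.
  rewrite (le_trans _ (ler_weXn2l q1 (leqnSn _)))//.
  elim: s => [|i s IH]; first by rewrite big_nil.
  by rewrite big_cons exprS ler_pM//; [apply: prodr_ge0 => j _|exact: normr_tnth_le].
have expq : (1 + q) ^+ (size s).+1 <= (size s).+1`!%:R * expR (1 + q).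
  have := @expR_ge1Dxn R (1 + q) (size s); rewrite addr_ge0// => /(_ isT) h.
  rewrite -ler_pdivrMl ?ltr0n ?fact_gt0// mulrC.
  by apply: le_trans h; rewrite lerDr.
have expa : expR (- (a%:R * q)) <= expR (- q).
  by rewrite ler_expR lerN2 ler_peMl// ler1n.
have mon0 : 0 <= \prod_(i <- s) `|tnth (phi t) i| by exact: prodr_ge0.
apply: le_trans (ler_pM (expR_ge0 _) mon0 expa (le_trans monle expq)) _.
by rewrite mulrCA -expRD addrCA addNr addr0.
Qed.

Lemma bounded_gauss_monomial a s : (0 < a)%N ->
  bounded_measurable (gauss_monomial a s).
Proof.
move=> a0; split; first exact: measurable_gauss_monomial.
by exists ((size s).+1`!%:R * expR 1) => t; exact: normr_gauss_monomial_le.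
Qed.

Lemma gauss_kernelE a s t : gauss_kernel a s t =
  expR (- (a%:R * sqr_norm (phi s))) * expR (- (a%:R * sqr_norm (phi t))) *
  expR (2 * a%:R * dot (phi s) (phi t)).
Proof.
rewrite -!expRD /gauss_kernel /sqr_norm /dot; congr expR.
rewrite -[2 * _ * _]mulrA -!mulrN -!mulrDr.
rewrite [2 * _]mulrCA -mulrDr; congr (_ * _).
rewrite mulr_sumr -!sumrN -!big_split; apply: eq_bigr => i _ /=; ring.
Qed.

Definition gauss_kernel_approx (a N : nat) (s t : T) : R :=
  expR (- (a%:R * sqr_norm (phi s))) * expR (- (a%:R * sqr_norm (phi t))) *
  series (exp_coeff (2 * a%:R * dot (phi s) (phi t))) N.

Lemma cvg_gauss_kernel_approx a s t :
  gauss_kernel_approx a N s t @[N --> \oo] --> gauss_kernel a s t.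
Proof.
rewrite gauss_kernelE; apply: cvgM; first exact: cvg_cst.
exact: is_cvg_series_exp_coeff.
Qed.

Lemma normr_dot_le (u v : m.-tuple R) : 2 * `|dot u v| <= sqr_norm u + sqr_norm v.
Proof.
rewrite /dot /sqr_norm -big_split/=.
apply: le_trans (ler_wpM2l _ (ler_norm_sum _ _ _)) _ => //.
rewrite mulr_sumr ler_sum// => i _; rewrite normrM.
rewrite -[tnth u i ^+ 2]real_normK ?num_real// -[tnth v i ^+ 2]real_normK ?num_real//.
rewrite -subr_ge0.
have := sqr_ge0 (`|tnth u i| - `|tnth v i|); congr (_ <= _); ring.
Qed.

(** Only the mixed factor of the kernel is truncated. The partial sum is at most exp(2a |<phi s, phi
    t>|), which the two Gaussian prefactors absorb since 2|<u, v>| <= |u|^2 + |v|^2; the bound is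
    uniform in [N], as dominated convergence requires. *)
Lemma normr_gauss_kernel_approx_le a N s t : `|gauss_kernel_approx a N s t| <= 1.
Proof.
rewrite /gauss_kernel_approx -expRD normrM ger0_norm ?expR_ge0//.
apply: le_trans (ler_wpM2l (expR_ge0 _) (series_exp_coeff_le _ _)) _.
rewrite -expRD -[leRHS]expR0 ler_expR.
rewrite !normrM !normr_nat -opprD -mulrDr addrC subr_le0 mulrAC mulrC.
by rewrite ler_wpM2l// normr_dot_le.
Qed.

(** The j-th power of the inner product is distributed over the words of length j in the
    coordinates. Each term is a nonnegative multiple of some g(t) g(s), so integrating in both
    variables produces squares. *)
Lemma gauss_kernel_approxE a N s t : gauss_kernel_approx a N s t =
  \sum_(0 <= j < N) \sum_(i : {ffun 'I_j -> 'I_m})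
    ((2 * a%:R) ^+ j / j`!%:R * gauss_monomial a (codom i) t) *
    gauss_monomial a (codom i) s.
Proof.
rewrite /gauss_kernel_approx /series/= mulr_sumr; apply: eq_bigr => j _.
rewrite /exp_coeff/= [in LHS]exprMn.
have -> : dot (phi s) (phi t) ^+ j = \sum_(i : {ffun 'I_j -> 'I_m})
    \prod_(l <- codom i) tnth (phi s) l * \prod_(l <- codom i) tnth (phi t) l.
  rewrite /dot -{1}(card_ord j) -prodr_const bigA_distr_bigA/=.
  by apply: eq_bigr => i _; rewrite big_split/= !big_image.
rewrite /gauss_monomial; move: (expR _) (expR _) => es et.
by rewrite mulr_sumr mulr_suml mulr_sumr; apply: eq_bigr => i _; ring.
Qed.

End gaussian_kernel.

Section gaussian_energy.
Context d (T : measurableType d) (R : realType).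
Variables (mu : {measure set T -> \bar R}) (f : T -> R).
Hypothesis intf : mu.-integrable setT (EFin \o f).
Variables (m : nat) (phi : T -> m.-tuple R).
Hypothesis mphi : measurable_fun setT phi.
Hypothesis f0 : \int[mu]_t f t = 0.

Local Notation L := (integral_against mu f).

Lemma normr_integral_against_le F : bounded_measurable F ->
  (forall t, `|F t| <= 1) -> `|L F| <= \int[mu]_t `|f t|.
Proof.
move=> bF F1; have iF := bounded_measurable_integrable intf bF.
apply: (le_trans (le_normr_Rintegral measurableT iF)).
apply: le_Rintegral => //; [exact: integrable_norm iF|exact: integrable_norm intf|].
by move=> t _; rewrite normrM ler_piMl.
Qed.

(* Expanding the kernel turns the double integral into a series of squares of
   the moments, with positive coefficients. *)
Lemma gauss_moment0 (a : nat) (c : R) (s : seq 'I_m) : (0 < a)%N ->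
  {ae mu, forall t, L (gauss_kernel phi a ^~ t) * f t = c * f t} ->
  L (gauss_monomial phi a s) = 0.
Proof.
move=> a0 hc; pose k j : R := (2 * a%:R) ^+ j / j`!%:R.
have bg s' : bounded_measurable (gauss_monomial phi a s').
  exact: bounded_gauss_monomial.
have [bcst bD bM blim] := @bounded_measurable_algebra _ T R.
pose g j (i : {ffun 'I_j -> 'I_m}) := gauss_monomial phi a (codom i).
pose h N t := L (gauss_kernel_approx phi a N ^~ t).
pose h' t := L (gauss_kernel phi a ^~ t).
have bapp N t : bounded_measurable (gauss_kernel_approx phi a N ^~ t).
  rewrite (funext (gauss_kernel_approxE phi a N ^~ t)).
  apply: bounded_measurable_sum => j; apply: bounded_measurable_sum => i.
  exact/bounded_measurableZ/bg.
have hE N : h N = fun t => \sum_(0 <= j < N) \sum_(i : {ffun 'I_j -> 'I_m})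
    (k j * L (g j i)) * g j i t.
  apply/funext => t; rewrite /h (funext (gauss_kernel_approxE phi a N ^~ t)).
  rewrite integral_against_sum//; last first.
    by move=> j; apply: bounded_measurable_sum => i; exact/bounded_measurableZ/bg.
  apply: eq_bigr => j _; rewrite integral_against_sum//; last first.
    by move=> i; exact/bounded_measurableZ/bg.
  by apply: eq_bigr => i _; rewrite integral_againstZ// -/(g j i) mulrAC.
have bh N : bounded_measurable (h N).
  rewrite hE; apply: bounded_measurable_sum => j.
  by apply: bounded_measurable_sum => i; exact/bounded_measurableZ/bg.
have LhE N : L (h N) = \sum_(0 <= j < N) \sum_(i : {ffun 'I_j -> 'I_m})
    k j * L (g j i) ^+ 2.
  rewrite hE integral_against_sum//; last first.
    by move=> j; apply: bounded_measurable_sum => i; exact/bounded_measurableZ/bg.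
  apply: eq_bigr => j _; rewrite integral_against_sum//; last first.
    by move=> i; exact/bounded_measurableZ/bg.
  by apply: eq_bigr => i _; rewrite integral_againstZ ?expr2 ?mulrA//; exact: bg.
have hI N t : `|h N t| <= \int[mu]_t `|f t|.
  apply: normr_integral_against_le => // u.
  exact: normr_gauss_kernel_approx_le.
have hh' t : h N t @[N --> \oo] --> h' t.
  apply: (integral_against_lim intf (K := 1)) => // [N u|u].
    exact: normr_gauss_kernel_approx_le.
  exact: cvg_gauss_kernel_approx.
have bh' := blim _ _ _ bh hI hh'.
(* Up to a null set the potential [h'] equals c wherever f is nonzero, so its integral against f is
   c times that of f, which is 0. *)
have Lh' : L h' = 0.
  transitivity (L (cst c)).
    congr fine; apply: ae_eq_integral => //.
    - exact: (measurable_int mu (bounded_measurable_integrable intf bh')).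
    - exact: (measurable_int mu (bounded_measurable_integrable intf (bcst c))).
    - by apply: filterS hc => t /= ht _; rewrite /h' ht.
  rewrite -[cst c](_ : (fun t => c * cst 1 t) = _); last first.
    by apply/funext => t /=; rewrite mulr1.
  rewrite (integral_againstZ intf c (bcst 1)).
  by rewrite /L; under eq_Rintegral do rewrite mul1r; rewrite f0 mulr0.
have := integral_against_lim intf bh hI hh'; rewrite [L h' in X in X -> _]Lh' => cLh.
have k0 j : 0 < k j.
  by rewrite divr_gt0 ?ltr0n ?fact_gt0// exprn_gt0// mulr_gt0 ?ltr0n.
(* The partial sums increase to 0, so each is at most 0; having nonnegative terms, they force every
   square to vanish. *)
have Lnd : nondecreasing_seq (fun N => L (h N)).
  apply/nondecreasing_seqP => N; rewrite !LhE big_nat_recr//= lerDl.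
  by apply: sumr_ge0 => i _; rewrite mulr_ge0 ?sqr_ge0// ltW.
(* The word [s] itself, as an index in the sum over words of length [size s]. *)
pose i := [ffun l => tnth (in_tuple s) l].
have gs : g _ i = gauss_monomial phi a s.
  congr gauss_monomial; rewrite codomE (eq_map (ffunE _)).
  by rewrite -[RHS](map_tnth_enum (in_tuple s)).
have := nondecreasing_cvgn_le Lnd (cvgP _ cLh) (size s).+1.
rewrite (cvg_lim _ cLh)// LhE big_nat_recr//= (bigD1 i)//= gs => S0.
have : k (size s) * L (gauss_monomial phi a s) ^+ 2 <= 0.
  apply: le_trans S0; rewrite addrCA lerDl addr_ge0//; apply: sumr_ge0 => j _.
    by apply: sumr_ge0 => l _; rewrite mulr_ge0 ?sqr_ge0// ltW.
  by rewrite mulr_ge0 ?sqr_ge0// ltW.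
by rewrite pmulr_rle0// => ?; apply/eqP; rewrite -sqrf_eq0 eq_le sqr_ge0 andbT.
Qed.

(** The coordinates of phi may be unbounded, so the generators are exp(-|phi|^2), for [None], and
    exp(-|phi|^2) phi_i, for [Some i]. Their quotients recover phi_i, which makes phi measurable for
    the sets whose indicators lie in the annihilated algebra. *)
Lemma integral_preimage0 (Q : set (m.-tuple R)) :
  (forall a, (0 < a)%N -> exists c,
    {ae mu, forall t, L (gauss_kernel phi a ^~ t) * f t = c * f t}) ->
  measurable Q -> \int[mu]_(t in phi @^-1` Q) f t = 0.
Proof.
move=> hc mQ.
pose y (o : option 'I_m) := gauss_monomial phi 1 (seq_of_opt o).
have by_ o : bounded_measurable (y o) by exact: bounded_gauss_monomial.
(* Each generator contributes one Gaussian factor, while only the [Some] entries contribute a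
   coordinate. *)
have prodE s t : \prod_(o <- s) y o t =
    gauss_monomial phi (size s) (pmap id s) t.
  elim: s => [|o s IH].
    by rewrite !big_nil /gauss_monomial big_nil mul0r oppr0 expR0 mul1r.
  have sE : (size (o :: s))%:R = (size s)%:R + 1 :> R by rewrite natr1.
  rewrite big_cons IH /y /gauss_monomial sE mulrDl mul1r opprD expRD.
  by case: o {sE} => [i|] /=; rewrite ?big_cons ?big_nil/=; ring.
have L0 s : L (fun t => \prod_(o <- s) y o t) = 0.
  (* The empty product has a = 0, outside the reach of [gauss_moment0]; it is the constant 1 and is
     covered by [f0]. *)
  rewrite (funext (prodE s)); case: s => [|o s].
    rewrite -[RHS]f0; apply: eq_Rintegral => t _.
    by rewrite /gauss_monomial big_nil mul0r oppr0 expR0 !mul1r.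
  by have [//|c] := hc (size (o :: s)); exact: gauss_moment0.
have [M [MA My M0]] := moments0_algebra intf by_ L0.
have bdd o t : `|y o t| <= (size (seq_of_opt o)).+1`!%:R * expR 1.
  exact: normr_gauss_monomial_le.
have my o := measurable_fun_algebra_sets MA (My o) (bdd o).
have mphi' : measurable_fun setT
    (phi : g_sigma_algebraType (algebra_sets M) -> m.-tuple R).
  apply/measurable_fun_tnthP => i.
  (* Division by the positive generator [y None] is written with exp and ln, whose measurability is
     at hand. *)
  rewrite (_ : _ \o _ = fun t => y (Some i) t * expR (- ln (y None t))); last first.
    apply/funext => t; rewrite /y /gauss_monomial /= big_seq1 big_nil mulr1.
    by rewrite expRK opprK mulrAC -expRD addNr expR0 mul1r.
  apply: measurable_funM => //; apply: measurableT_comp => //.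
  by apply: measurableT_comp => //; apply: measurableT_comp => //; exact: measurable_ln.
have mM : M \1_(phi @^-1` Q).
  apply: (measurable_algebra_setsE MA).
  by rewrite -[X in measurable X]setTI; exact: mphi'.
rewrite -[RHS](M0 _ mM) Rintegral_mkcond; apply: eq_Rintegral => t _.
by rewrite patchE indicE; case: ifPn => _; rewrite ?mul1r ?mul0r.
Qed.

End gaussian_energy.

(** * Preimages under an injective map *)

Section tuple_topology.
Context {R : realType}.

Definition row_tuple n (v : 'rV[R]_n) : n.-tuple R := [tuple v ord0 i | i < n].

Definition tuple_row n (t : n.-tuple R) : 'rV[R]_n := \row_i tnth t i.

Lemma tuple_rowK n : cancel (@tuple_row n) (@row_tuple n).
Proof. by move=> t; apply: eq_from_tnth => i; rewrite tnth_mktuple mxE. Qed.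

Lemma row_tupleK n : cancel (@row_tuple n) (@tuple_row n).
Proof. by move=> v; apply/rowP => i; rewrite mxE tnth_mktuple. Qed.

(** The topology is that of row vectors, transported along [row_tuple]. *)
Definition tuple_closed n (C : set (n.-tuple R)) := closed (@row_tuple n @^-1` C).

Lemma measurable_tuple_box n (A : 'I_n -> set R) :
  (forall i, measurable (A i)) ->
  measurable [set t : n.-tuple R | forall i, A i (tnth t i)].
Proof.
move=> mA; rewrite (_ : mkset _ = \bigcap_(i in [set: 'I_n])
    ((fun t : n.-tuple R => tnth t i) @^-1` A i)); last first.
  by apply/seteqP; split => t /= At i; [move=> _; exact: At|exact: At].
apply: fin_bigcap_measurable => // i _.
by rewrite -[X in measurable X]setTI; exact: measurable_tnth.
Qed.

(** The complement is open, hence the union of the countably many rational boxes that it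
    contains. *)
Lemma measurable_tuple_closed n (C : set (n.-tuple R)) :
  tuple_closed C -> measurable C.
Proof.
move=> cC; rewrite -[C]setCK; apply: measurableC.
pose box (r : {ffun 'I_n -> rat * rat}) := [set t : n.-tuple R |
  forall i, `](ratr (r i).1), (ratr (r i).2)[%classic (tnth t i)].
pose B r := if `[< box r `<=` ~` C >] then box r else set0.
rewrite (_ : ~` C = \bigcup_r B r).
  apply: countable_bigcupT_measurable; first exact: countableP.
  move=> r; rewrite /B; case: ifPn => // _.
  by apply: (@measurable_tuple_box _
    (fun i => `](ratr (r i).1), (ratr (r i).2)[%classic)) => i; exact: measurable_itv.
apply/seteqP; split => [t Ct|t [r _]]; last first.
  by rewrite /B; case: ifPn => // /asboolP rC; exact: rC.
have : nbhs (tuple_row t) (~` (@row_tuple n @^-1` C)).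
  by apply: open_nbhs_nbhs; split; [exact: closed_openC|rewrite /= tuple_rowK].
move=> [P nP PC].
have {}nP i : nbhs (tnth t i) (P ord0 i) by have := nP ord0 i; rewrite mxE.
have ex i : exists q : rat * rat,
    `](ratr q.1), (ratr q.2)[%classic (tnth t i) /\
    `](ratr q.1), (ratr q.2)[%classic `<=` P ord0 i.
  have /nbhs_ballP[e /= e0 eP] := nP i.
  have [q1] : exists q : rat, ratr q \in `](tnth t i - e), (tnth t i)[.
    by apply: rat_in_itvoo; rewrite ltrBlDr ltrDl.
  have [q2] : exists q : rat, ratr q \in `](tnth t i), (tnth t i + e)[.
    by apply: rat_in_itvoo; rewrite ltrDl.
  rewrite !in_itv/= => /andP[tq2 q2t] /andP[tq1 q1t]; exists (q1, q2).
  rewrite /= in_itv/= q1t tq2; split => // x /=; rewrite in_itv/= => /andP[q1x xq2].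
  by apply: eP; rewrite /ball/= ltr_norml; apply/andP; split; lra.
have [q qP] := choice ex.
exists [ffun i => q i] => //; rewrite /B asboolT; last first.
  move=> u bu; rewrite -(tuple_rowK u); apply: PC => i j.
  by rewrite ord1 mxE; apply: (qP j).2; have := bu j; rewrite ffunE.
by move=> i; rewrite ffunE; exact: (qP i).1.
Qed.

Lemma tuple_closed_ge n (i : 'I_n) (c : R) :
  tuple_closed [set t : n.-tuple R | c <= tnth t i].
Proof.
rewrite /tuple_closed (_ : _ @^-1` _ =
  (fun v : 'rV[R]_n => v ord0 i) @^-1` [set x | c <= x]).
  by apply: preimage_closed; [move=> v _; exact: coord_continuous|exact: closed_ge].
by apply/seteqP; split => v /=; rewrite tnth_mktuple.
Qed.

Lemma tuple_closed_le n (i : 'I_n) (c : R) :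
  tuple_closed [set t : n.-tuple R | tnth t i <= c].
Proof.
rewrite /tuple_closed (_ : _ @^-1` _ =
  (fun v : 'rV[R]_n => v ord0 i) @^-1` [set x | x <= c]).
  by apply: preimage_closed; [move=> v _; exact: coord_continuous|exact: closed_le].
by apply/seteqP; split => v /=; rewrite tnth_mktuple.
Qed.

Definition tuple_bounded n (C : set (n.-tuple R)) :=
  exists M : R, forall t, C t -> forall i, `|tnth t i| <= M.

Definition rtuple n1 n2 (t : (n1 + n2).-tuple R) : n2.-tuple R :=
  [tuple tnth t (rshift n1 i) | i < n2].

Definition tuple_compact n (C : set (n.-tuple R)) :=
  tuple_closed C /\ tuple_bounded C.

Lemma tuple_compact0 n : tuple_compact (@set0 (n.-tuple R)).
Proof. by split; [exact: closed0|exists 0]. Qed.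

Lemma tuple_compactU n (C C' : set (n.-tuple R)) :
  tuple_compact C -> tuple_compact C' -> tuple_compact (C `|` C').
Proof.
move=> [cC [M CM]] [cC' [M' CM']]; split; first exact: closedU.
by exists (Num.max M M') => t [/CM|/CM'] h i; rewrite le_max h ?orbT.
Qed.

Lemma tuple_compact_box n (C : set (n.-tuple R)) (M : R) : tuple_closed C ->
  tuple_compact (C `&` [set t | forall i, `|tnth t i| <= M]).
Proof.
move=> cC; split; last by exists M => t [].
suff cB : tuple_closed [set t : n.-tuple R | forall i, `|tnth t i| <= M].
  exact: closedI.
rewrite /tuple_closed (_ : _ @^-1` _ = \bigcap_(i in [set: 'I_n])
    @row_tuple n @^-1` ([set t | - M <= tnth t i] `&` [set t | tnth t i <= M])).
  apply: closed_bigI => i _.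
  rewrite preimage_setI; apply: closedI; first exact: tuple_closed_ge.
  exact: tuple_closed_le.
apply/seteqP; split => v /= h i; first by move=> _; apply/andP; rewrite -ler_norml.
by rewrite ler_norml; apply/andP; exact: h.
Qed.

(** Boundedness is essential, as projections of closed sets need not be closed: a closed bounded set
    is compact, and so is its continuous image. *)
Lemma tuple_closed_rtuple n1 n2 (C : set ((n1 + n2).-tuple R)) :
  tuple_compact C -> tuple_closed (@rtuple n1 n2 @` C).
Proof.
move=> [cC [M CM]].
have kC : compact (@row_tuple (n1 + n2) @^-1` C).
  have kM : compact [set v : 'rV[R]_(n1 + n2) | forall i, `[- M, M]%classic (v ord0 i)].
    by apply: (@rV_compact _ _ (fun=> `[- M, M]%classic)) => _; exact: segment_compact.
  apply: (subclosed_compact cC kM) => v Cv i.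
  by have := CM _ Cv i; rewrite tnth_mktuple ler_norml /= in_itv.
have cr : continuous (@rsubmx R 1 n1 n2).
  (* A product neighbourhood of the right block is extended by the full line on the left columns. *)
  move=> v A [P nP PA]; pose Q (i : 'I_1) (j : 'I_(n1 + n2)) := match fintype.split j with
    | inl _ => setT | inr j => P i j end.
  exists Q => [i j|w Qw].
    rewrite /Q; case: fintype.splitP => [j' _|l jl].
      by apply/nbhs_ballP; exists 1 => /=.
    by have := nP i l; rewrite mxE; congr (nbhs (v _ _) _); exact: val_inj.
  apply: PA => i j; have := Qw i (rshift n1 j); rewrite /Q mxE.
  by rewrite (unsplitK (inr j)).
rewrite /tuple_closed (_ : _ @^-1` _ =
  @rsubmx R 1 n1 n2 @` (@row_tuple (n1 + n2) @^-1` C)).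
  apply: compact_closed; first exact: norm_hausdorff.
  by apply: continuous_compact kC; exact: continuous_subspaceT.
have rE (w : 'rV[R]_(n1 + n2)) : rtuple (row_tuple w) = row_tuple (rsubmx w).
  by apply: eq_from_tnth => i; rewrite !tnth_mktuple mxE.
apply/seteqP; split => v /=.
  move=> [t Ct tv]; exists (tuple_row t); first by rewrite /= tuple_rowK.
  by apply: (can_inj (@row_tupleK _)); rewrite -rE tuple_rowK.
by move=> [w Cw <-]; exists (row_tuple w) => //; exact: rE.
Qed.

End tuple_topology.

(** * Inner regularity of finite Borel measures *)

Section inner_regularity.
Local Open Scope ereal_scope.
Context (R : realType) (n : nat).
Variable G : {measure set (n.-tuple R) -> \bar R}.
Hypothesis Gfin : G setT < +oo.

Definition inner_regular (B : set (n.-tuple R)) := measurable B /\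
  forall e : R, (0 < e)%R -> exists F,
    [/\ tuple_compact F, F `<=` B & G (B `\` F) <= e%:E].

Lemma finite_measure_lty B : measurable B -> G B < +oo.
Proof. by move=> mB; apply: le_lt_trans Gfin; rewrite le_measure// inE. Qed.

Lemma tuple_compact_inner_regular F : tuple_compact F -> inner_regular F.
Proof.
move=> cF; split=> [|e e0]; first exact: measurable_tuple_closed cF.1.
by exists F; split => //; rewrite setDv measure0 lee_fin ltW.
Qed.

Lemma inner_regular_bigcap (B : nat -> set (n.-tuple R)) :
  (forall i, inner_regular (B i)) -> inner_regular (\bigcap_i B i).
Proof.
move=> rB; split=> [|e e0]; first by apply: bigcapT_measurable => i; case: (rB i).
have /choice[F FP] : forall i, exists F, [/\ tuple_compact F, F `<=` B i &
    G (B i `\` F) <= (e / (2 ^ i.+1)%:R)%:E].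
  by move=> i; apply: (rB i).2; rewrite divr_gt0// ltr0n expn_gt0.
exists (\bigcap_i F i); split.
- split; first by apply: closed_bigI => i _; have [[]] := FP i.
  by have [[_ [M FM]] _ _] := FP 0%N; exists M => t Ft; exact: FM (Ft 0%N I).
- by apply: subset_bigcap => i _; case: (FP i).
have mF i : measurable (F i).
  by apply: measurable_tuple_closed; have [[]] := FP i.
apply: le_trans (epsilon_trick0 xpredT (ltW e0)).
apply: (@le_trans _ _ (\sum_(0 <= i <oo) G (B i `\` F i))).
  apply: measure_sigma_subadditive.
  - by move=> i; apply: measurableD => //; case: (rB i).
  - by apply: measurableD; apply: bigcapT_measurable => // i; case: (rB i).
  - move=> t [Bt]; rewrite -[~ _]/((~` \bigcap_i F i) t) setC_bigcap => -[i _ Fit].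
    by exists i => //; split => //; exact: Bt.
by apply: lee_nneseries => // i *; case: (FP i).
Qed.

(** An infinite union of compact sets need not be compact. Half of e pays for the approximations;
    continuity from above, which uses that [G] is finite, then allows a finite union. *)
Lemma inner_regular_bigcup (B : nat -> set (n.-tuple R)) :
  (forall i, inner_regular (B i)) -> inner_regular (\bigcup_i B i).
Proof.
move=> rB; split=> [|e e0]; first by apply: bigcupT_measurable => i; case: (rB i).
have e20 : (0 < e / 2)%R by rewrite divr_gt0.
have /choice[F FP] : forall i, exists F, [/\ tuple_compact F, F `<=` B i &
    G (B i `\` F) <= (e / 2 / (2 ^ i.+1)%:R)%:E].
  by move=> i; apply: (rB i).2; rewrite divr_gt0// ltr0n expn_gt0.
have mF i : measurable (F i).
  by apply: measurable_tuple_closed; have [[]] := FP i.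
have mB : measurable (\bigcup_i B i).
  by apply: bigcupT_measurable => i; case: (rB i).
pose U N := \big[setU/set0]_(i < N) F i.
have mU N : measurable (U N) by exact: bigsetU_measurable.
pose D N := (\bigcup_i B i) `\` U N.
have cvgD : (G \o D) N @[N --> \oo] --> G (\bigcap_N D N).
  apply: nonincreasing_cvg_mu.
  - by apply: finite_measure_lty; exact: measurableD.
  - by move=> N; exact: measurableD.
  - by apply: bigcapT_measurable => N; exact: measurableD.
  - move=> N M NM; apply/subsetPset; apply: setDS.
    exact: subset_bigsetU.
have DE : G (\bigcap_N D N) <= (e / 2)%:E.
  apply: le_trans (epsilon_trick0 xpredT (ltW e20)).
  apply: (@le_trans _ _ (\sum_(0 <= i <oo) G (B i `\` F i))).
    apply: measure_sigma_subadditive.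
    - by move=> i; apply: measurableD => //; case: (rB i).
    - by apply: bigcapT_measurable => N; exact: measurableD.
    - move=> t Dt; have [[i _ Bit] _] := Dt 0%N I.
      exists i => //; split => // Fit; have [_] := Dt i.+1 I; apply.
      by rewrite /U big_ord_recr/=; right.
  by apply: lee_nneseries => // i *; case: (FP i).
(* The strict inequality e / 2 < e is what lets the convergence get below e at a finite stage. *)
have Dlt : G (\bigcap_N D N) < e%:E.
  by apply: le_lt_trans DE _; rewrite lte_fin ltr_pdivrMr// ltr_pMr// ltr1n.
have [N _ /(_ _ (leqnn N)) DN] :
    \forall N \near \oo, (G \o D) N <= e%:E.
  have : nbhs (G (\bigcap_N D N)) [set x | x < e%:E].
    by apply: open_nbhs_nbhs; split => //; exact: open_ereal_lt_ereal.
  by move=> /cvgD[N _ h]; exists N => // M /h /ltW.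
exists (U N); split => //.
- rewrite /U; elim/big_ind : _ => //; first exact: tuple_compact0.
    by move=> *; exact: tuple_compactU.
  by move=> i _; case: (FP i).
- rewrite /U -bigcup_mkord => t [i _ Fit]; exists i => //.
  by case: (FP i) => _ FB _; exact: FB.
Qed.

Lemma tuple_closed_inner_regular C : tuple_closed C -> inner_regular C.
Proof.
move=> cC; pose box N := [set t : n.-tuple R | forall i, (`|tnth t i| <= N%:R)%R].
rewrite (_ : C = \bigcup_N (C `&` box N)).
  by apply: inner_regular_bigcup => N; exact/tuple_compact_inner_regular/tuple_compact_box.
apply/seteqP; split => [t Ct|t [N _ []]//].
exists (\max_(i < n) (Num.truncn `|tnth t i|).+1); first by [].
split => // i; rewrite (le_trans (ltW (truncnS_gt _)))// ler_nat.
exact: (leq_bigmax i).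
Qed.

(** Stability under complement is not visible for inner regularity alone, so a set and its
    complement are treated together. Closed half-spaces generate, and an open half-space is a
    countable union of closed ones. *)
Lemma measurable_inner_regular B : measurable B -> inner_regular B.
Proof.
pose RR := [set B | inner_regular B /\ inner_regular (~` B)].
have sRR : sigma_algebra setT RR.
  have R0 : inner_regular set0 by apply: tuple_closed_inner_regular; exact: closed0.
  have RT : inner_regular setT by apply: tuple_closed_inner_regular; exact: closedT.
  split.
  - by split => //; rewrite setC0.
  - by move=> C [C1 C2]; rewrite setTD; split => //; rewrite setCK.
  - move=> F RF; split; first by apply: inner_regular_bigcup => i; case: (RF i).
    by rewrite setC_bigcup; apply: inner_regular_bigcap => i; case: (RF i).
(* Measurability of the identity from [RR] to tuples says that [RR] contains every Borel set. *)
move=> mB; have mid : measurable_fun setT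
    (id : g_sigma_algebraType RR -> n.-tuple R).
  apply/measurable_fun_tnthP => i; apply: (measurability (@RGenCInfty.G R)).
    exact: RGenCInfty.measurableE.
  move=> _ [_ [c ->] <-]; apply: sub_sigma_algebra; rewrite setTI.
  rewrite (_ : _ @^-1` _ = [set t | (c <= tnth t i)%R]); last first.
    by apply/seteqP; split => t /=; rewrite in_itv/= andbT.
  split; first by apply: tuple_closed_inner_regular; exact: tuple_closed_ge.
  rewrite (_ : ~` _ = \bigcup_k [set t | (tnth t i <= c - k.+1%:R^-1)%R]).
    apply: inner_regular_bigcup => k; apply: tuple_closed_inner_regular.
    exact: tuple_closed_le.
  apply/seteqP; split => t /=.
    move=> /negP; rewrite -ltNge -subr_gt0 => tc.
    have [k _ /(_ _ (leqnn k)) /= kt] := near_infty_natSinv_lt (PosNum tc).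
    by exists k => //=; rewrite lerBrDr -lerBrDl; exact: ltW kt.
  move=> [k _ /= tk]; apply/negP; rewrite -ltNge; apply: le_lt_trans tk _.
  by rewrite ltrBlDr ltrDl.
have := mid measurableT B mB; rewrite setTI preimage_id => mB'.
by have [] := mB' RR (conj sRR (@subset_refl _ RR)).
Qed.

End inner_regularity.

(** * From preimages under phi to all measurable sets *)

Section injective_preimages.
Context (R : realType) (n m : nat).
Variables (mu : {measure set (n.-tuple R) -> \bar R}) (f : n.-tuple R -> R).
Hypothesis intf : mu.-integrable setT (EFin \o f).
Variable phi : n.-tuple R -> m.-tuple R.
Hypothesis mphi : measurable_fun setT phi.

Definition graph_tuple (t : n.-tuple R) : (n + m).-tuple R :=
  [tuple of t ++ phi t].

Definition ltuple (u : (n + m).-tuple R) : n.-tuple R :=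
  [tuple tnth u (lshift m i) | i < n].

Lemma graph_tupleKl t : ltuple (graph_tuple t) = t.
Proof. by apply: eq_from_tnth => i; rewrite tnth_mktuple tnth_lshift. Qed.

Lemma graph_tupleKr t : rtuple (graph_tuple t) = phi t.
Proof. by apply: eq_from_tnth => i; rewrite tnth_mktuple tnth_rshift. Qed.

Lemma measurable_graph_tuple : measurable_fun setT graph_tuple.
Proof.
apply/measurable_fun_tnthP => i; rewrite -[i]splitK; case: (fintype.split i) => j /=.
  rewrite (_ : _ \o _ = (fun t => tnth t j)); first exact: measurable_tnth.
  by apply/funext => t /=; rewrite tnth_lshift.
rewrite (_ : _ \o _ = (fun t => tnth (phi t) j)).
  exact: measurableT_comp (measurable_tnth j) mphi.
by apply/funext => t /=; rewrite tnth_rshift.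
Qed.

Lemma measurable_ltuple : measurable_fun setT ltuple.
Proof.
apply/measurable_fun_tnthP => i.
rewrite (_ : _ \o _ = (fun u => tnth u (lshift m i))); first exact: measurable_tnth.
by apply/funext => u /=; rewrite tnth_mktuple.
Qed.

(* The unused arguments let the measure instance be found by unification. *)
Definition graph_measure_of
    of mu.-integrable setT (EFin \o f) & measurable_fun setT phi :=
  fun B : set ((n + m).-tuple R) =>
  (\int[mu]_(t in graph_tuple @^-1` B) `|f t|%:E)%E.

Local Notation graph_measure := (graph_measure_of intf mphi).

Let graph_measure0 : graph_measure set0 = 0%E.
Proof. by rewrite /graph_measure_of preimage_set0 integral_set0. Qed.

Let graph_measure_ge0 B : (0 <= graph_measure B)%E.
Proof. by apply: integral_ge0 => t _; rewrite lee_fin. Qed.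

Let graph_measure_sigma_additive : semi_sigma_additive graph_measure.
Proof.
move=> F mF tF mUF; rewrite /graph_measure_of preimage_bigcup.
have mgF i : measurable (graph_tuple @^-1` F i).
  by rewrite -[X in measurable X]setTI; exact: measurable_graph_tuple.
apply: semi_sigma_additive_nng_induced => //.
- apply/measurable_EFinP/measurableT_comp => //.
  by apply/measurable_EFinP; exact: (measurable_int mu intf).
- apply/trivIsetP => i j _ _ ij.
  have /trivIsetP/(_ i j I I ij) FF0 := tF.
  by rewrite -preimage_setI FF0 preimage_set0.
- exact: bigcup_measurable.
Qed.

HB.instance Definition _ := isMeasure.Build _ _ _ graph_measure
  graph_measure0 graph_measure_ge0 graph_measure_sigma_additive.

Lemma graph_measure_lty : (graph_measure setT < +oo)%E.
Proof. by have /integrableP[] := intf. Qed.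

(** Written as conditions on u, the graph is the zero set of finitely many measurable functions, and
    no image has to be considered. *)
Lemma measurable_graph (A : set (n.-tuple R)) : measurable A ->
  measurable [set u : (n + m).-tuple R | A (ltuple u) /\ phi (ltuple u) = rtuple u].
Proof.
move=> mA; rewrite (_ : [set u | _] = ltuple @^-1` A `&`
    \bigcap_(i in [set: 'I_m])
      (fun u => tnth (phi (ltuple u)) i - tnth u (rshift n i)) @^-1` [set 0]).
  apply: measurableI.
    by rewrite -[X in measurable X]setTI; exact: measurable_ltuple.
  apply: fin_bigcap_measurable => // i _.
  rewrite -[X in measurable X]setTI.
  suff : measurable_fun setT
    (fun u : (n + m).-tuple R => tnth (phi (ltuple u)) i - tnth u (rshift n i)).
    by apply => //; exact: measurable_set1.
  apply: measurable_funB; last exact: measurable_tnth.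
  apply: (measurableT_comp (measurable_tnth i)).
  exact: (measurableT_comp mphi measurable_ltuple).
apply/seteqP; split => u /= [Au].
  by move=> pu; split => // i _ /=; rewrite pu tnth_mktuple subrr.
move=> pu; split => //; apply: eq_from_tnth => i; rewrite [RHS]tnth_mktuple.
by apply/eqP; rewrite -subr_eq0; apply/eqP; exact: pu i I.
Qed.

(* Since phi is injective, a compact subset K of the graph over A is the graph
   over A `&` phi @^-1` Q where Q, the projection of K, is compact. *)
Lemma ae0_of_preimages (D : set (n.-tuple R)) : measurable D ->
  (forall s t, D s -> D t -> phi s = phi t -> s = t) ->
  (forall t, ~ D t -> f t = 0) ->
  (forall Q, measurable Q -> \int[mu]_(t in phi @^-1` Q) f t = 0) ->
  {ae mu, forall t, f t = 0}.
Proof.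
move=> mD injphi fD0 fQ0.
have iE E : measurable E -> mu.-integrable E (EFin \o f).
  by move=> mE; exact: integrableS intf.
have A0 A : measurable A -> A `<=` D -> \int[mu]_(t in A) f t = 0.
  move=> mA AD; apply/eqP; rewrite -normr_eq0; apply/eqP/le_anti.
  rewrite normr_ge0 andbT; apply/ler_addgt0Pr => e e0; rewrite add0r.
  have mG := measurable_graph mA; set Ga := [set u | _] in mG.
  have [_ /(_ e e0)[K [kK KG GK]]] := measurable_inner_regular graph_measure_lty mG.
  pose Q := @rtuple _ n m @` K.
  have mK : measurable K by apply: measurable_tuple_closed; case: kK.
  have mQ : measurable Q by apply: measurable_tuple_closed; exact: tuple_closed_rtuple kK.
  have mpQ : measurable (phi @^-1` Q).
    by rewrite -[X in measurable X]setTI; exact: mphi.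
  (* A point of [D] above [Q] shares its phi-value with a point of [A], so by injectivity it is that
     point. *)
  have QA : phi @^-1` Q `&` D `<=` A.
    move=> t [[u Ku up] Dt]; have [Au pu] := KG _ Ku.
    by rewrite -(injphi (ltuple u) t)//; [exact: AD|rewrite pu].
  have QE : phi @^-1` Q `&` D = A `&` phi @^-1` Q.
    apply/seteqP; split => t; last by move=> [/AD].
    by move=> QDt; split; [exact: QA|case: QDt].
  have : \int[mu]_(t in A `&` phi @^-1` Q) f t = 0.
    rewrite -QE -[RHS](fQ0 _ mQ) Rintegral_mkcondr; apply: eq_Rintegral => t _.
    by rewrite patchE; case: ifPn => //; rewrite notin_setE => /fD0.
  have mAQ : measurable (A `\` phi @^-1` Q) by exact: measurableD.
  move=> AQ0; rewrite -(setUIDK A (phi @^-1` Q)) Rintegral_setU//; last first.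
  - by apply/disj_setPS => t [[_ Qt] [_]].
  - by apply: iE; rewrite setUIDK.
  - exact: measurableI.
  rewrite AQ0 add0r -lee_fin EFin_normr_Rintegral//; last exact: iE.
  (* What remains of [A] lifts to points of the graph outside [K], where the mass of |f| is at most
     e. *)
  apply: le_trans GK; apply: (le_trans (le_abse_integral _ _ _)) => //.
    exact: (measurable_int mu (iE _ mAQ)).
  have mGK : measurable (graph_tuple @^-1` (Ga `\` K)).
    rewrite -[X in measurable X]setTI; apply: measurable_graph_tuple => //.
    exact: measurableD.
  apply: ge0_subset_integral => //.
  - apply: measurableT_comp => //; exact: (measurable_int mu (iE _ mGK)).
  - move=> t [At nQ]; split; first by rewrite /Ga /= graph_tupleKl graph_tupleKr.
    by move=> Kt; apply: nQ; exists (graph_tuple t) => //; exact: graph_tupleKr.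
have : ae_eq mu setT (EFin \o f) (cst 0%E).
  apply: integral_ae_eq => // E _ mE; rewrite integral0.
  have := A0 (E `&` D) (measurableI _ _ mE mD) (@subIsetr _ _ _).
  rewrite Rintegral_mkcondr => E0.
  rewrite -[LHS]fineK ?integrable_fin_num//; last exact: iE.
  rewrite -[0%E]/(0%:E); congr EFin; rewrite -[RHS]E0; apply: eq_Rintegral => t _.
  by rewrite patchE; case: ifPn => //; rewrite notin_setE => /fD0.
by apply: filterS => t /(_ I) [].
Qed.

End injective_preimages.

(** * From balls to Gaussian kernels *)

(** A discrete layer-cake formula: counting the integer levels below y recovers y up to 1. The level
    n+1 is left out because, as a superlevel set of the Gaussian, it would be a ball of radius 0. *)
Lemma count_le_bounds (R : realDomainType) (y : R) n : 0 <= y <= n.+1%:R ->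
  `|\sum_(i < n) ((i.+1%:R <= y)%R)%:R - y| <= 1.
Proof.
move=> /andP[y0 yn]; pose S k : R := \sum_(i < k) ((i.+1%:R <= y)%R)%:R.
have SP k : (k%:R <= y -> S k = k%:R) /\
    (y < k%:R -> y - 1 < S k /\ S k <= y).
  elim: k => [|k [IH1 IH2]].
    by rewrite /S big_ord0; split => //; rewrite ltNge y0.
  rewrite /S big_ord_recr/= -/(S k); split => [ky|yk].
    by rewrite ky IH1 ?natr1// (le_trans _ ky)// ler_nat.
  rewrite [k.+1%:R <= y]leNgt yk addr0; have [ky|/IH2//] := leP k%:R y.
  by rewrite IH1//; split => //; rewrite ltrBlDr natr1.
have [Sge Slt] := SP n.
rewrite -/(S n) ler_norml; have [ny|/Slt[]] := leP n%:R y.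
  by rewrite (Sge ny); apply/andP; split; move: yn; rewrite -natr1; lra.
by move=> ? ?; apply/andP; split; lra.
Qed.

Section kernel_of_balls.
Context d (T : measurableType d) (R : realType).
Variables (mu : {measure set T -> \bar R}) (f : T -> R).
Hypothesis intf : mu.-integrable setT (EFin \o f).
Variables (m : nat) (phi : T -> m.-tuple R).
Hypothesis mphi : measurable_fun setT phi.

Local Notation L := (integral_against mu f).

(* The radii of the superlevel sets {K >= i.+1 / n.+1} of the Gaussian K *)
Definition gauss_radius (a n i : nat) : R :=
  Num.sqrt (ln (n.+1%:R / i.+1%:R) / a%:R).

Lemma gauss_radius_gt0 a n i : (0 < a)%N -> (i < n)%N -> 0 < gauss_radius a n i.
Proof.
move=> a0 ni; rewrite sqrtr_gt0 divr_gt0 ?ltr0n// ln_gt0//.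
by rewrite ltr_pdivlMr ?ltr0n// mul1r ltr_nat.
Qed.

Lemma embedding_dist_le_radius a n i s t : (0 < a)%N -> (i < n)%N ->
  (embedding_dist phi s t <= gauss_radius a n i) =
  (i.+1%:R <= n.+1%:R * gauss_kernel phi a s t).
Proof.
move=> a0 ni; rewrite /embedding_dist /euclidean_dist /gauss_radius /gauss_kernel.
set q := \sum_(_ < _) _.
have q1 : 1 < n.+1%:R / i.+1%:R :> R.
  by rewrite ltr_pdivlMr ?ltr0n// mul1r ltr_nat.
rewrite ler_sqrt; last by rewrite divr_ge0// ltW// ln_gt0.
rewrite ler_pdivlMr ?ltr0n// -ler_expR lnK; last by rewrite posrE divr_gt0 ?ltr0n.
by rewrite expRN !ler_pdivlMr ?expR_gt0 ?ltr0n// (mulrC q) (mulrC (expR _)).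
Qed.

Lemma measurable_embedding_dist t : measurable_fun setT (embedding_dist phi ^~ t).
Proof.
apply: (measurableT_comp (f := @Num.sqrt R)).
  apply: continuous_measurable_fun; exact: sqrt_continuous.
apply: measurable_sum => i; apply: measurable_funX; apply: measurable_funB => //.
exact: measurable_tnth_phi.
Qed.

(** [F n u] gives weight 1 / (n+1) to each of n superlevel sets of the Gaussian and is within 1 /
    (n+1) of it. Since f vanishes off [D], restricting these sets to [D] does not change the
    integrals. *)
Lemma gauss_kernel_eq_of_balls (D : set T) (a : nat) (t t0 : T) : (0 < a)%N ->
  (forall s, ~ D s -> f s = 0) ->
  (forall n i, (i < n)%N ->
    \int[mu]_(s in embedding_ball D phi t (gauss_radius a n i)) f s =
    \int[mu]_(s in embedding_ball D phi t0 (gauss_radius a n i)) f s) ->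
  L (gauss_kernel phi a ^~ t) = L (gauss_kernel phi a ^~ t0).
Proof.
move=> a0 fD0 fB.
pose I n i u : T -> R := \1_[set s | embedding_dist phi s u <= gauss_radius a n i].
pose F n u s := \sum_(i < n) n.+1%:R^-1 * I n i u s.
have bI n i u : bounded_measurable (I n i u).
  split; last first.
    by exists 1 => s; rewrite /I indicE; case: (_ \in _); rewrite ?normr1 ?normr0.
  apply: measurable_indic; rewrite -[X in measurable X]setTI.
  exact: measurable_fun_le (measurable_embedding_dist u) (measurable_cst _).
have bF n u : bounded_measurable (F n u).
  by apply: bounded_measurable_sum => i; exact: bounded_measurableZ.
have LF n u : L (F n u) = \sum_(i < n) n.+1%:R^-1 *
    \int[mu]_(s in embedding_ball D phi u (gauss_radius a n i)) f s.
  rewrite integral_against_sum//; last by move=> i; exact: bounded_measurableZ.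
  apply: eq_bigr => i _; rewrite integral_againstZ//; congr (_ * _).
  rewrite [RHS]Rintegral_mkcond; apply: eq_Rintegral => s _.
  rewrite patchE /I indicE; have [Ds|Ds] := pselect (D s); last first.
    by rewrite fD0// mulr0; case: ifP.
  rewrite (_ : (s \in embedding_ball _ _ _ _) =
    (s \in [set s | embedding_dist phi s u <= gauss_radius a n i])).
    by case: ifP => _; rewrite ?mul1r ?mul0r.
  by apply/idP/idP; rewrite !inE; [case|move=> sr; split].
have K01 s u : 0 <= gauss_kernel phi a s u <= 1.
  rewrite expR_ge0 -expR0 ler_expR oppr_le0 mulr_ge0//.
  by apply: sumr_ge0 => i _; exact: sqr_ge0.
have FK n u s : `|F n u s - gauss_kernel phi a s u| <= n.+1%:R^-1.
  have n0 : 0 < n.+1%:R :> R by rewrite ltr0n.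
  rewrite /F -mulr_sumr -(ler_pM2l n0) divff ?gt_eqF// -{1}(gtr0_norm n0) -normrM.
  rewrite mulrBr mulVKf ?gt_eqF//.
  have := @count_le_bounds R (n.+1%:R * gauss_kernel phi a s u) n.
  have /andP[k0 k1] := K01 s u.
  rewrite mulr_ge0//= ler_piMr// => /(_ isT); congr (`|_ - _| <= _).
  apply: eq_bigr => i _; rewrite /I indicE -embedding_dist_le_radius//.
  by congr (nat_of_bool _)%:R; apply/idP/idP; rewrite inE.
have F2 n u s : `|F n u s| <= 2.
  have := FK n u s; have /andP[k0 k1] := K01 s u.
  have : n.+1%:R^-1 <= 1 :> R by rewrite invf_le1 ?ltr0n// ler1n.
  move: k0 k1; move: (n.+1%:R^-1) (F n u s) (gauss_kernel phi a s u) => x y z.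
  by rewrite !ler_norml => ? ? ? /andP[? ?]; apply/andP; split; lra.
have FcK u s : F ^~ u ^~ s @ \oo --> gauss_kernel phi a s u.
  apply/cvgrPdist_le => e e0; near=> n.
  rewrite distrC; apply: le_trans (FK n u s) _.
  by apply: ltW; near: n; exact: near_infty_natSinv_lt (PosNum e0).
have LK u : L (F n u) @[n --> \oo] --> L (gauss_kernel phi a ^~ u).
  exact: (integral_against_lim intf (bF ^~ u) (F2 ^~ u) (FcK u)).
apply: (cvg_unique _ (LK t)) => //.
have -> : (fun n => L (F n t)) = (fun n => L (F n t0)); last exact: LK.
apply/funext => n; rewrite !LF; apply: eq_bigr => i _; by rewrite fB.
Unshelve. all: by end_near.
Qed.

End kernel_of_balls.

(** * Null sets and their sections *)

Section fubini_sections.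
Context d1 d2 (S : measurableType d1) (T : measurableType d2) (R : realType).
Variables (kap : {sigma_finite_measure set S -> \bar R})
  (lam : {sigma_finite_measure set T -> \bar R}).

(** Tonelli computes the measure of [N] in either order, which turns null sets of x chosen
    separately for each t into a null set of t for almost every x. *)
Lemma ae_xsection0 (N : set (S * T)) : measurable N ->
  (forall t, kap (ysection N t) = 0%E) ->
  {ae kap, forall x, lam (xsection N x) = 0%E}.
Proof.
move=> mN N0; have mxN := measurable_fun_xsection lam mN.
have : ae_eq kap setT (lam \o xsection N) (cst 0%E).
  apply/ae_eq_integral_abs => //.
  under eq_integral do rewrite gee0_abs//.
  have := indic_fubini_tonelli kap lam mN.
  rewrite indic_fubini_tonelli_FE// indic_fubini_tonelli_GE// => ->.
  by rewrite (eq_integral (cst 0%E)) ?integral0// => t _ /=; exact: N0.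
by apply: filterS => x /(_ I).
Qed.

Lemma product_measure0 (N : set (S * T)) : measurable N ->
  {ae kap, forall x, lam (xsection N x) = 0%E} -> (kap \x lam)%E N = 0%E.
Proof.
move=> mN N0; have mxN := measurable_fun_xsection lam mN.
rewrite /product_measure1 (ae_eq_integral (cst 0%E))//; first by rewrite integral0.
by apply: filterS N0 => x Nx _ /=.
Qed.

(** Tonelli is applied to nonnegative integrands, which is why the two densities are kept apart in
    what follows and subtracted only after integration. *)
Lemma measurable_Rintegral_section (g : S * T -> R) :
  measurable_fun setT g -> (forall z, 0 <= g z) ->
  measurable_fun setT (fun x => \int[lam]_t g (x, t)).
Proof.
move=> mg g0; apply: (measurableT_comp (f := fine)).
  exact: fine_measurable.
apply: (measurable_fun_fubini_tonelli_F (m2 := lam) (EFin \o g)).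
  exact/measurable_EFinP.
by move=> z; rewrite lee_fin.
Qed.

End fubini_sections.

Lemma measurable_gauss_kernel d (T : measurableType d) (R : realType) m
    (phi : T -> m.-tuple R) (a : nat) : measurable_fun setT phi ->
  measurable_fun setT (fun z : T * T => gauss_kernel phi a z.1 z.2).
Proof.
move=> mphi; have mi i := measurable_tnth_phi mphi i.
apply: measurableT_comp => //; apply: measurableT_comp => //.
apply: measurable_funM => //; apply: measurable_sum => i; apply: measurable_funX.
apply: measurable_funB.
  exact: (measurableT_comp (mi i) measurable_fst).
exact: (measurableT_comp (mi i) measurable_snd).
Qed.

Lemma Rintegral_mulr_indic d (T : measurableType d) (R : realType)
    (mu : {measure set T -> \bar R}) (g : T -> R) (B : set T) :
  \int[mu]_t (g t * \1_B t) = \int[mu]_(t in B) g t.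
Proof.
rewrite [RHS]Rintegral_mkcond; apply: eq_Rintegral => t _.
by rewrite patchE indicE; case: ifP => _; rewrite ?mulr1 ?mulr0.
Qed.

(** * Ball averages and potentials of the difference *)

Section ball_averages.
Context d1 d2 (S : measurableType d1) (T : measurableType d2) (R : realType).
Variables (kap : {sigma_finite_measure set S -> \bar R})
  (lam : {sigma_finite_measure set T -> \bar R}).
Variables (X : set S) (D : set T) (m : nat) (phi : T -> m.-tuple R).
Hypotheses (mX : measurable X) (mD : measurable D) (mphi : measurable_fun setT phi).
Variables (P Q : S * T -> R).
Hypotheses (mP : measurable_fun setT P) (mQ : measurable_fun setT Q).
Hypotheses (P_ge0 : forall z, 0 <= P z) (Q_ge0 : forall z, 0 <= Q z).
Hypotheses (P1 : forall x, X x -> (\int[lam]_t (P (x, t))%:E = 1)%E)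
  (Q1 : forall x, X x -> (\int[lam]_t (Q (x, t))%:E = 1)%E).
Hypotheses (P0 : forall x t, ~ D t -> P (x, t) = 0)
  (Q0 : forall x t, ~ D t -> Q (x, t) = 0).
Variable pX : S -> R.
Hypothesis pX_int : kap.-integrable X (EFin \o pX).
Hypothesis pX_gt0 : {ae kap, forall x, X x -> 0 < pX x}.

Let f x t := P (x, t) - Q (x, t).

Hypothesis hball : forall theta : S -> T, measurable_fun X theta ->
  (forall x, X x -> D (theta x)) -> forall r : R, 0 < r ->
  \int[kap]_(x in X) (pX x * \int[lam]_(t in embedding_ball D phi (theta x) r) f x t) = 0.

Let density_integrable (p : S * T -> R) x : measurable_fun setT p ->
  (forall z, 0 <= p z) -> (\int[lam]_t (p (x, t))%:E = 1)%E ->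
  lam.-integrable setT (EFin \o (fun t => p (x, t))).
Proof.
move=> mp p_ge0 p1; apply/integrableP; split.
  by apply/measurable_EFinP; exact: measurable_fun_pair2.
rewrite (eq_integral (fun t => (p (x, t))%:E)) ?p1 ?ltry// => t _ /=.
by rewrite ger0_norm.
Qed.

Lemma difference_integrable x : X x -> lam.-integrable setT (EFin \o f x).
Proof.
move=> Xx; rewrite (_ : EFin \o f x =
  ((EFin \o (fun t => P (x, t))) \- (EFin \o (fun t => Q (x, t))))%E); last first.
  by apply/funext.
by apply: integrableB => //; apply: density_integrable => //; [exact: P1|exact: Q1].
Qed.

Lemma integral_difference x : X x -> \int[lam]_t f x t = 0.
Proof.
move=> Xx; rewrite RintegralB//; [|apply: density_integrable => //; exact: P1|
  apply: density_integrable => //; exact: Q1].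
by rewrite /Rintegral P1// Q1// subrr.
Qed.

Lemma measurable_embedding_ball t r : measurable (embedding_ball D phi t r).
Proof.
apply: measurableI => //.
rewrite -[X in measurable X]setTI.
exact: measurable_fun_le (measurable_embedding_dist mphi t) (measurable_cst _).
Qed.

Let Rintegral_density (p : S * T -> R) B x : measurable B ->
  measurable_fun setT p -> (forall z, 0 <= p z) ->
  (\int[lam]_t (p (x, t))%:E = 1)%E ->
  0 <= \int[lam]_(t in B) p (x, t) <= 1.
Proof.
move=> mB mp p_ge0 p1; have ip := density_integrable mp p_ge0 p1.
rewrite Rintegral_ge0//= -lee_fin fineK; last first.
  by apply: integrable_fin_num => //; exact: integrableS ip.
rewrite -p1; apply: ge0_subset_integral => //.
- exact: (measurable_int lam ip).
- by move=> t _; rewrite lee_fin.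
Qed.

Let average B x := \int[lam]_(t in B) f x t.

Let averageE B x : measurable B -> X x -> average B x =
  \int[lam]_t (P (x, t) * \1_B t) - \int[lam]_t (Q (x, t) * \1_B t).
Proof.
move=> mB Xx; rewrite !Rintegral_mulr_indic /average RintegralB//.
- by apply: (integrableS measurableT) => //; apply: density_integrable => //; exact: P1.
- by apply: (integrableS measurableT) => //; apply: density_integrable => //; exact: Q1.
Qed.

Let measurable_average B : measurable B -> measurable_fun X (average B).
Proof.
move=> mB; have m1 (p : S * T -> R) : measurable_fun setT p -> (forall z, 0 <= p z) ->
    measurable_fun setT (fun x => \int[lam]_t (p (x, t) * \1_B t)).
  move=> mp p_ge0.
  apply: (measurable_Rintegral_section lam (g := fun z => p z * \1_B z.2)).
    apply: measurable_funM => //.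
    exact: (measurableT_comp (measurable_indic (D := setT) mB) measurable_snd).
  by move=> z; rewrite mulr_ge0// indicE.
apply: (eq_measurable_fun (fun x => \int[lam]_t (P (x, t) * \1_B t) -
  \int[lam]_t (Q (x, t) * \1_B t))).
  by move=> x; rewrite inE => Xx; rewrite averageE.
by apply: measurable_funTS; apply: measurable_funB; exact: m1.
Qed.

(** The average is a difference of two probabilities, hence lies in [-1, 1]. *)
Let weighted_integrable B : measurable B ->
  kap.-integrable X (EFin \o (fun x => pX x * average B x)).
Proof.
move=> mB; rewrite (_ : EFin \o _ = (EFin \o pX) \* (EFin \o average B))%E; last first.
  by apply/funext => x.
apply: integrableMl => //; first exact: measurable_average.
exists 1; split => // M M1 x Xx; apply: le_trans (ltW M1).
rewrite averageE// !Rintegral_mulr_indic ler_norml.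
have /andP[? ?] := Rintegral_density mB mP P_ge0 (P1 Xx).
have /andP[? ?] := Rintegral_density mB mQ Q_ge0 (Q1 Xx).
by apply/andP; split; lra.
Qed.

(* Test the hypothesis on the centre function equal to t on E and t0 off E. *)
Lemma ae_average_eq t t0 r : D t -> D t0 -> 0 < r ->
  {ae kap, forall x, X x -> \int[lam]_(s in embedding_ball D phi t r) f x s =
    \int[lam]_(s in embedding_ball D phi t0 r) f x s}.
Proof.
move=> Dt Dt0 r0; pose G u x := pX x * average (embedding_ball D phi u r) x.
have iG u : kap.-integrable X (EFin \o G u).
  by apply: weighted_integrable; exact: measurable_embedding_ball.
pose h x := G t x - G t0 x.
have ih : kap.-integrable X (EFin \o h).
  rewrite (_ : EFin \o h = (EFin \o G t) \- (EFin \o G t0))%E; last exact/funext.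
  exact: integrableB.
have h0 E : E `<=` X -> measurable E -> \int[kap]_(x in E) h x = 0.
  move=> EX mE; pose theta x := if x \in E then t else t0.
  have mtheta : measurable_fun X theta.
    apply: measurable_funTS; apply: measurable_fun_ifT => //.
    apply: (measurable_fun_bool true); rewrite setTI.
    rewrite (_ : _ @^-1` _ = E)//.
    by apply/seteqP; split => x; [exact: set_mem|exact: mem_set].
  have Dtheta x : X x -> D (theta x) by rewrite /theta; case: ifP.
  have Dcst : forall x : S, X x -> D (cst t0 x) by [].
  have := hball mtheta Dtheta r0; have := hball (measurable_cst t0) Dcst r0.
  have ihE : kap.-integrable X (EFin \o (h \_ E)).
    rewrite -restrict_EFin; apply/integrable_restrict => //.
    by apply: integrableS ih => //; exact: measurableI.
  rewrite -/(\int[kap]_(x in X) G t0 x) => G0.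
  (* The integrand for [theta] is the one for the constant centre [t0] plus h restricted to [E]; the
     hypothesis for both centre functions leaves the integral of h over [E]. *)
  rewrite (eq_Rintegral _ (g := fun x => G t0 x + (h \_ E) x)); last first.
    move=> x _; rewrite patchE /theta /h; case: ifP => _ //; last by rewrite addr0.
    by rewrite addrC subrK.
  rewrite RintegralD// [X in X + _]G0 add0r -Rintegral_mkcondr.
  by move/setIidr : EX => ->.
have hae : ae_eq kap X (EFin \o h) (cst 0%E).
  apply: integral_ae_eq => // E EX mE; rewrite integral0.
  rewrite -[LHS]fineK; first by rewrite -[0%E]/(0%:E); congr EFin; exact: h0.
  by apply: integrable_fin_num => //; exact: integrableS ih.
have cancel (c u v : R) : 0 < c -> c * u - c * v = 0 -> u = v.
  by move=> c0 /subr0_eq; apply: mulfI; rewrite gt_eqF.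
apply: filterS2 hae pX_gt0 => x hx px Xx; apply: cancel (px Xx) _.
by case: (hx Xx).
Qed.

Let potential a x t := integral_against lam (f x) (gauss_kernel phi a ^~ t).

(** For a fixed pair of centres the radii are indexed by two naturals, so only countably many null
    sets of x are discarded. *)
Let ae_potential_eq a t t0 : (0 < a)%N -> D t -> D t0 ->
  {ae kap, forall x, X x -> potential a x t = potential a x t0}.
Proof.
move=> a0 Dt Dt0.
pose E n i x := (i < n)%N -> X x ->
  \int[lam]_(s in embedding_ball D phi t (gauss_radius R a n i)) f x s =
  \int[lam]_(s in embedding_ball D phi t0 (gauss_radius R a n i)) f x s.
have : {ae kap, forall x, forall n i, E n i x}.
  apply: ae_foralln => n; apply: ae_foralln => i.
  have [ni|ni] := boolP (i < n)%N; last first.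
    by apply: aeW; move=> x ni'; exfalso; exact: (negP ni ni').
  have := ae_average_eq Dt Dt0 (gauss_radius_gt0 R a0 ni).
  by apply: filterS => x Ex _.
apply: filterS => x Ex Xx.
apply: (gauss_kernel_eq_of_balls (difference_integrable Xx) mphi a0 (D := D)).
  by move=> s Ds; rewrite /f P0// Q0// subrr.
by move=> n i ni; exact: Ex.
Qed.

Let kernel_against a (p : S * T -> R) (z : S * T) : R :=
  \int[lam]_s (gauss_kernel phi a s z.2 * p (z.1, s)).

Let measurable_kernel_against a (p : S * T -> R) : measurable_fun setT p ->
  (forall z, 0 <= p z) -> measurable_fun setT (kernel_against a p).
Proof.
move=> mp p_ge0.
apply: (measurable_Rintegral_section lam
  (g := fun w : (S * T) * T => gauss_kernel phi a w.2 w.1.2 * p (w.1.1, w.2))).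
  apply: measurable_funM.
    apply: (measurableT_comp (measurable_gauss_kernel a mphi)
      (g := fun w : (S * T) * T => (w.2, w.1.2))).
    apply: measurable_fun_pair => //.
    exact: (measurableT_comp measurable_snd measurable_fst).
  apply: (measurableT_comp mp (g := fun w : (S * T) * T => (w.1.1, w.2))).
  apply: measurable_fun_pair => //.
  exact: (measurableT_comp measurable_fst measurable_fst).
by move=> w; rewrite mulr_ge0// expR_ge0.
Qed.

Let potentialE a x t : X x ->
  potential a x t = kernel_against a P (x, t) - kernel_against a Q (x, t).
Proof.
move=> Xx; rewrite /potential /integral_against.
have bK : bounded_measurable (gauss_kernel phi a ^~ t).
  split; first exact: (measurable_fun_pair1 t (measurable_gauss_kernel a mphi)).
  exists 1 => s; rewrite ger0_norm ?expR_ge0// -expR0 ler_expR oppr_le0 mulr_ge0//.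
  by apply: sumr_ge0 => i _; exact: sqr_ge0.
rewrite -RintegralB//.
- by apply: eq_Rintegral => s _; rewrite mulrBr.
- apply: (bounded_measurable_integrable _ bK).
  by apply: density_integrable => //; exact: P1.
- apply: (bounded_measurable_integrable _ bK).
  by apply: density_integrable => //; exact: Q1.
Qed.

(** The null set in [ae_potential_eq] depends on t. The bad pairs form a jointly measurable set [N]
    whose section at every t is null, and [ae_xsection0] exchanges the roles of the variables. *)
Lemma ae_kernel_potential_cst t0 : D t0 ->
  {ae kap, forall x, X x -> forall a, (0 < a)%N -> {ae lam, forall t, D t ->
    integral_against lam (f x) (gauss_kernel phi a ^~ t) =
    integral_against lam (f x) (gauss_kernel phi a ^~ t0)}}.
Proof.
move=> Dt0.
suff : {ae kap, forall x, forall a, X x -> (0 < a)%N -> {ae lam, forall t, D t ->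
    potential a x t = potential a x t0}}.
  by apply: filterS => x h Xx a a0; exact: h.
apply: ae_foralln => a; have [a0|_] := ltnP 0 a; last first.
  exact: aeW.
pose H z := kernel_against a P z - kernel_against a Q z.
have mH : measurable_fun setT H.
  by apply: measurable_funB; exact: measurable_kernel_against.
have mH0 : measurable_fun setT (fun z : S * T => H (z.1, t0)).
  apply: (measurableT_comp mH (g := fun z : S * T => (z.1, t0))).
  exact: measurable_fun_pair.
pose N := (X `*` D) `&` ~` [set z : S * T | H z = H (z.1, t0)].
have mN : measurable N.
  apply: measurableI; first exact: measurableX.
  have mHB := measurable_funB mH mH0.
  apply: measurableC; rewrite -[X in measurable X]setTI.
  rewrite (_ : [set z | _] = (fun z => H z - H (z.1, t0)) @^-1` [set 0]).
    exact: mHB measurableT _ (measurable_set1 0).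
  apply/seteqP; split => z /=; first by move=> ->; rewrite subrr.
  by move/eqP; rewrite subr_eq0 => /eqP.
have N0 t : kap (ysection N t) = 0%E.
  apply/negligibleP; first exact: measurable_ysection.
  have [Dt|Dt] := pselect (D t); last first.
    rewrite (_ : ysection N t = set0); first exact: negligible_set0.
    by rewrite -subset0 => x /ysectionP[[]].
  have [M [mM M0 MP]] := ae_potential_eq a0 Dt Dt0.
  exists M; split => //; apply: subset_trans MP => x /ysectionP[[/= Xx _] HN] xE.
  have Et := potentialE a t Xx; have Et0 := potentialE a t0 Xx.
  exact: HN (etrans (esym Et) (etrans (xE Xx) Et0)).
have := ae_xsection0 lam mN N0; apply: filterS => x Nx Xx _.
exists (xsection N x); split => //; first exact: measurable_xsection.
move=> t tE; apply/xsectionP; split.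
  by split; [exact: Xx|apply: contrapT => Dt; apply: tE => /Dt[]].
move=> Hxt; apply: tE => _.
exact: etrans (potentialE a t Xx) (etrans Hxt (esym (potentialE a t0 Xx))).
Qed.

End ball_averages.

(** * Reduction to functions defined on the whole space *)

Local Open Scope ereal_scope.

Theorem theorem1 (R : realType) (D k m : nat)
    (Theta : set (D.-tuple R)) (X : set (k.-tuple R))
    (mTheta : measurable Theta) (mX : measurable X)
    (p q : k.-tuple R -> D.-tuple R -> R)
    (mp : measurable_fun (X `*` Theta) (fun z => p z.1 z.2))
    (mq : measurable_fun (X `*` Theta) (fun z => q z.1 z.2))
    (p_density : forall x, X x -> is_density (lebesgue_tuple R D) Theta (p x))
    (q_density : forall x, X x -> is_density (lebesgue_tuple R D) Theta (q x))
    (phi : D.-tuple R -> m.-tuple R)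
    (mphi : measurable_fun Theta phi)
    (phi_metric : is_metric_on Theta (embedding_dist phi))
    (phi_doubling : doubling Theta phi (lebesgue_tuple R D))
    (pX : k.-tuple R -> R)
    (pX_density : is_density (lebesgue_tuple R k) X pX)
    (pX_gt0 : {ae lebesgue_tuple R k, forall x, X x -> (0 < pX x)%R}) :
  (forall theta_l : k.-tuple R -> D.-tuple R,
     measurable_fun X theta_l ->
     (forall x, X x -> Theta (theta_l x)) ->
     forall r : R, (0 < r)%R ->
       \int[lebesgue_tuple R k]_(x in X)
         ((pX x)%:E *
          \int[lebesgue_tuple R D]_(t in embedding_ball Theta phi (theta_l x) r)
            (p x t - q x t)%:E) = 0) ->
  {ae lebesgue_tuple R k \x lebesgue_tuple R D,
    forall z, (X `*` Theta) z -> (p z.1 z.2 - q z.1 z.2 = 0)%R}.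
Proof.
move=> hyp.
(* An empty [X] makes the claim vacuous. Otherwise some density on [Theta] integrates to 1, so
   [Theta] contains a reference centre. *)
have [X0|[x0 Xx0]] : X = set0 \/ X !=set0 by have [|/set0P] := eqVneq X set0; [left|right].
  by apply: aeW => z []; rewrite X0.
have [t0 Tt0] : Theta !=set0.
  apply/set0P/negP => /eqP T0; have [_ _] := p_density _ Xx0.
  by rewrite T0 integral_set0 => /esym/eqP; rewrite onee_eq0.
(* The densities are extended by 0 and phi by a default value. The difference vanishes off [Theta]
   and balls stay inside [Theta], so no integral changes. *)
pose P := (fun z => p z.1 z.2) \_ (X `*` Theta).
pose Q := (fun z => q z.1 z.2) \_ (X `*` Theta).
pose phi' := phi \_ Theta.
have mXT : measurable (X `*` Theta) by exact: measurableX.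
have mP : measurable_fun setT P by exact: (measurable_restrictT _ mXT).1 mp.
have mQ : measurable_fun setT Q by exact: (measurable_restrictT _ mXT).1 mq.
have mphi' : measurable_fun setT phi' by exact: (measurable_restrictT _ mTheta).1 mphi.
have PE x t : X x -> Theta t -> P (x, t) = p x t.
  by move=> Xx Tt; rewrite /P patchE mem_set.
have QE x t : X x -> Theta t -> Q (x, t) = q x t.
  by move=> Xx Tt; rewrite /Q patchE mem_set.
have phiE t : Theta t -> phi' t = phi t by move=> Tt; rewrite /phi' patchE mem_set.
have P0 x t : ~ Theta t -> P (x, t) = 0%R.
  by move=> Tt; rewrite /P patchE memNset// => -[].
have Q0 x t : ~ Theta t -> Q (x, t) = 0%R.
  by move=> Tt; rewrite /Q patchE memNset// => -[].
have P_ge0 z : (0 <= P z)%R.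
  rewrite /P patchE; case: ifPn => //; rewrite inE => -[Xz Tz].
  by have [_ + _] := p_density _ Xz; apply.
have Q_ge0 z : (0 <= Q z)%R.
  rewrite /Q patchE; case: ifPn => //; rewrite inE => -[Xz Tz].
  by have [_ + _] := q_density _ Xz; apply.
have P1 x : X x -> \int[lebesgue_tuple R D]_t (P (x, t))%:E = 1.
  move=> Xx; have [_ _ <-] := p_density _ Xx; rewrite [RHS]integral_mkcond.
  apply: eq_integral => t _; rewrite patchE; case: ifPn.
    by rewrite inE => Tt; rewrite PE.
  by rewrite notin_setE => Tt; rewrite P0.
have Q1 x : X x -> \int[lebesgue_tuple R D]_t (Q (x, t))%:E = 1.
  move=> Xx; have [_ _ <-] := q_density _ Xx; rewrite [RHS]integral_mkcond.
  apply: eq_integral => t _; rewrite patchE; case: ifPn.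
    by rewrite inE => Tt; rewrite QE.
  by rewrite notin_setE => Tt; rewrite Q0.
have pX_int : (lebesgue_tuple R k).-integrable X (EFin \o pX).
  have [mpX pX0 pX1] := pX_density; apply/integrableP; split.
    exact/measurable_EFinP.
  rewrite (eq_integral (fun x => (pX x)%:E)) ?pX1 ?ltry// => x; rewrite inE => Xx.
  by rewrite /= ger0_norm// pX0.
have ballE t r : Theta t -> embedding_ball Theta phi' t r = embedding_ball Theta phi t r.
  by move=> Tt; apply/seteqP; split => s [Ts];
    rewrite /embedding_ball /= /embedding_dist (phiE s Ts) (phiE t Tt).
have intf x := @difference_integrable _ _ _ _ R (lebesgue_tuple R D) X P Q
  mP mQ P_ge0 Q_ge0 P1 Q1 x.
have hball (theta : k.-tuple R -> D.-tuple R) : measurable_fun X theta ->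
    (forall x, X x -> Theta (theta x)) -> forall r : R, (0 < r)%R ->
    (\int[lebesgue_tuple R k]_(x in X) (pX x *
      \int[lebesgue_tuple R D]_(t in embedding_ball Theta phi' (theta x) r)
        (P (x, t) - Q (x, t))) = 0)%R.
  move=> mtheta Ttheta r r0; rewrite -[RHS]/(fine 0) -(hyp _ mtheta Ttheta r r0).
  congr fine; apply: eq_integral => x; rewrite inE => Xx.
  rewrite EFinM ballE; last exact: Ttheta.
  have mB : measurable (embedding_ball Theta phi (theta x) r).
    by rewrite -ballE; [exact: measurable_embedding_ball|exact: Ttheta].
  congr (_ * _); rewrite fineK; last first.
    by apply: integrable_fin_num => //; apply: integrableS (intf x Xx).
  by apply: eq_integral => t; rewrite inE => -[Tt _]; rewrite PE// QE.
(* Equal images are at distance 0, so the separation axiom of the metric gives injectivity on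
   [Theta]. *)
have injphi s t : Theta s -> Theta t -> phi' s = phi' t -> s = t.
  move=> Ts Tt; rewrite !phiE// => st; have [_ /(_ s t Ts Tt)[+ _] _ _] := phi_metric.
  apply; rewrite /embedding_dist /euclidean_dist st big1 ?sqrtr0// => i _.
  by rewrite subrr expr0n.
have main := ae_kernel_potential_cst mX mTheta mphi' mP mQ P_ge0 Q_ge0 P1 Q1 P0 Q0
  pX_int pX_gt0 hball Tt0.
have mPQ : measurable_fun setT (fun z => P z - Q z)%R by exact: measurable_funB.
(* The claim fails exactly on [Z], so it suffices that almost every section of [Z] is null. *)
pose Z := (X `*` Theta) `&` (fun z => P z - Q z)%R @^-1` (~` [set 0%R]).
have mZ : measurable Z.
  apply: measurableI => //; rewrite -[X in measurable X]setTI.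
  by apply: mPQ => //; apply: measurableC; exact: measurable_set1.
exists Z; split => //.
  apply: product_measure0 => //; apply: filterS main => x xpot.
  apply/negligibleP; first exact: measurable_xsection.
  have [Xx|Xx] := pselect (X x); last first.
    rewrite (_ : xsection Z x = set0); first exact: negligible_set0.
    by rewrite -subset0 => t /xsectionP[[]].
  have f0 := integral_difference mP mQ P_ge0 Q_ge0 P1 Q1 Xx.
  have fD0 t : ~ Theta t -> (P (x, t) - Q (x, t) = 0)%R.
    by move=> Tt; rewrite P0// Q0// subrr.
  have mulr_eq0r (u v w : R) : (w = 0 -> u * w = v * w)%R.
    by move=> ->; rewrite !mulr0.
  have fQ0 B : measurable B ->
      (\int[lebesgue_tuple R D]_(t in phi' @^-1` B) (P (x, t) - Q (x, t)) = 0)%R.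
    apply: (integral_preimage0 (intf x Xx) mphi' f0) => a a0.
    (* The constant is the potential at [t0]. Off [Theta] the potential may differ from it, but both
       sides carry a factor that vanishes there. *)
    exists (integral_against (lebesgue_tuple R D)
      (fun t => P (x, t) - Q (x, t))%R (gauss_kernel phi' a ^~ t0)).
    apply: filterS (xpot Xx a a0) => t tpot.
    have [Tt|nTt] := pselect (Theta t); first by rewrite (tpot Tt).
    exact: mulr_eq0r (fD0 t nTt).
  have := ae0_of_preimages (intf x Xx) mphi' mTheta injphi fD0 fQ0.
  by apply: negligibleS => t /xsectionP[_ /= ?].
move=> [x t] /= pq; have [[Xx Tt] pq0] := (not_implyP _ _).1 pq.
by split => //; rewrite /= PE// QE.
Qed.
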